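(* Let $p_1 = 2, p_2 = 3, p_3 = 5, \dots$ denote the prime numbers listed in increasing order. For real $x, y > 1$ define $$F(x,y) = \sum_{k=1}^{\infty} x^{k-1}\frac{y^{-x^k}}{(1-y^{-x^k})^2}$$ and $$QNC(x,y) = \frac{1}{12xy}\bigl( x(y-1)F(x,y) - y(x-1)F(y,x)\bigr).$$ Let $\mathbf{R} = [\mathbf{R}_{ij}]_{i,j\ge 1}$ be the infinite matrix with entries $\mathbf{R}_{ij} = QNC(p_i, p_j)$. Then $\mathbf{R}$, acting by matrix multiplication on the Hilbert space $\ell_2$ of square-summable complex column vectors, defines a trace class operator on $\ell_2$.
   Context: A bounded operator $\mathbf{A}$ on a Hilbert space is trace class if the positive operator $|\mathbf{A}| = (\mathbf{A}^*\mathbf{A})^{1/2}$ has pure discrete spectrum with summable eigenvalues (equivalently, the singular values of $\mathbf{A}$ are summable). *)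

(* Defs.v *)
From Stdlib Require Import Reals Znumtheory ZArith.
From Coquelicot Require Import Coquelicot.
Open Scope R_scope.

(** F(x,y) = sum_{k>=1} x^(k-1) y^(-x^k) / (1 - y^(-x^k))^2, reindexed from k = 0. *)
Definition Fxy (x y : R) : R :=
  Series (fun k : nat =>
    x ^ k * Rpower y (- x ^ (S k)) / (1 - Rpower y (- x ^ (S k))) ^ 2).

Definition QNC (x y : R) : R :=
  / (12 * x * y) * (x * (y - 1) * Fxy x y - y * (x - 1) * Fxy y x).

Definition prime_enum (p : nat -> nat) : Prop :=
  (forall n, prime (Z.of_nat (p n))) /\
  (forall n, (p n < p (S n))%nat) /\
  (forall q : nat, prime (Z.of_nat q) -> exists n, p n = q).

Definition vec := nat -> C.

Definition l2 (x : vec) : Prop := ex_series (fun n => (Cmod (x n)) ^ 2).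

Definition l2norm (x : vec) : R := sqrt (Series (fun n => (Cmod (x n)) ^ 2)).

Definition inner (x y : vec) : C :=
  (Series (fun n => Re (Cmult (x n) (Cconj (y n)))),
   Series (fun n => Im (Cmult (x n) (Cconj (y n))))).

Definition vadd (x y : vec) : vec := fun n => Cplus (x n) (y n).
Definition vscal (c : C) (x : vec) : vec := fun n => Cmult c (x n).

Definition bounded_op (T : vec -> vec) : Prop :=
  (forall x, l2 x -> l2 (T x)) /\
  (forall x y, l2 x -> l2 y -> forall i, T (vadd x y) i = Cplus (T x i) (T y i)) /\
  (forall (c : C) x, l2 x -> forall i, T (vscal c x) i = Cmult c (T x i)) /\
  (exists M : R, forall x, l2 x -> l2norm (T x) <= M * l2norm x).

Definition onb (e : nat -> vec) : Prop :=
  (forall n, l2 (e n)) /\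
  (forall m n, inner (e m) (e n) = if Nat.eqb m n then RtoC 1 else RtoC 0) /\
  (forall x, l2 x -> (forall n, inner x (e n) = RtoC 0) -> forall i, x i = RtoC 0).

Definition positive_op (P : vec -> vec) : Prop :=
  forall x, l2 x -> 0 <= Re (inner (P x) x) /\ Im (inner (P x) x) = 0.

(** A is trace class: A is bounded and |A| = (A^* A)^{1/2} (the positive
    operator P with P^2 = A^* A, i.e. <P(Px), y> = <Ax, Ay>) has pure discrete
    spectrum (an orthonormal basis of eigenvectors) with summable eigenvalues
    (counted with multiplicity). *)
Definition trace_class (A : vec -> vec) : Prop :=
  bounded_op A /\
  exists P : vec -> vec,
    bounded_op P /\ positive_op P /\
    (forall x y, l2 x -> l2 y -> inner (P (P x)) y = inner (A x) (A y)) /\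
    exists (e : nat -> vec) (lam : nat -> R),
      onb e /\ (forall n i, P (e n) i = Cmult (RtoC (lam n)) (e n i)) /\
      ex_series lam.

Definition mat_conv (M : nat -> nat -> R) (x : vec) : Prop :=
  forall i, ex_series (fun j => M i j * fst (x j)) /\
            ex_series (fun j => M i j * snd (x j)).

Definition mat_apply (M : nat -> nat -> R) (x : vec) : vec :=
  fun i => (Series (fun j => M i j * fst (x j)), Series (fun j => M i j * snd (x j))).

(* Main.v *)
Require Import Defs.
From Stdlib Require Import Reals Znumtheory ZArith.
From Coquelicot Require Import Coquelicot.
From Stdlib Require Import Lra Lia Classical ClassicalEpsilon FunctionalExtensionality.
Open Scope R_scope.

(** For [x, y >= 2] the series [F(x,y)] is [O(y^(-x))], so [|QNC(x,y)| <= 2 (y^(-x) + x^(-y))].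
    As [p_i >= i + 2] (counting from 0), this gives [|R i j| <= u i * u j] with [u] summable,
    and every real matrix dominated in this way is trace class.

    Writing [A] for the operator and [B = A^T A], the spectral theorem on real
    sequences gives an orthonormal basis [e] of eigenvectors of [B].  The singular values
    [s n = |A e_n| = <A e_n, f_n>], where [f_n = A e_n / |A e_n|], are summable because
    [2 <A e_n, f_n> <= U (sum_j u_j e_n(j)^2 + sum_j u_j f_n(j)^2)] with [U = sum_j u_j], and
    by Bessel's inequality the right-hand sides add up to at most [2 U^2].  Then
    [P x = sum_n s_n <x, e_n> e_n] is [|A|]; everything extends to complex sequences
    componentwise. *)

(** * Finite sums and series *)

(** [QNC] is antisymmetric, so the matrix has no nonzero real eigenvalue; [A^T A] is real and
    symmetric, which is why it is diagonalized instead and why real eigenvectors suffice. The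
    encoding of trace class asks for one sequence of eigenvectors that is total in the whole space,
    kernel included. Choosing eigenvectors by decreasing eigenvalue would fail: with infinitely many
    positive eigenvalues the kernel is never reached. The selection therefore goes by an auxiliary
    weight that does not see eigenvalues. The bound [u i * u j] serves three times. It makes the
    operator bounded. It replaces compactness: bounded coordinatewise convergent sequences have norm
    convergent images, so maximizing sequences can be handled coordinate by coordinate. It gives
    summability, because the quadratic form of the diagonal matrix [u] has total at most [U] over
    any orthogonal system. *)

Fixpoint psum (a : nat -> R) (N : nat) : R :=
  match N with O => 0 | S n => psum a n + a n end.

(** [sum_n a n] includes index [n], while [psum a N] stops before index [N], so that inductions over
    finite systems can start from an empty sum. *)
Lemma psum_sum_n (a : nat -> R) (n : nat) : psum a (S n) = sum_n a n.
Proof.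
  induction n as [|n IH].
  - rewrite sum_O. simpl. ring.
  - rewrite sum_Sn, <- IH. reflexivity.
Qed.

Lemma is_series_psum (a : nat -> R) (l : R) :
  is_series a l <-> is_lim_seq (psum a) l.
Proof.
  rewrite (is_lim_seq_incr_1 (psum a)).
  split; intro H.
  - apply is_lim_seq_ext with (2 := H). intro n. symmetry. apply psum_sum_n.
  - apply (is_lim_seq_ext _ (sum_n a)) in H; [exact H|]. apply psum_sum_n.
Qed.

Lemma Series_psum (a : nat -> R) : ex_series a -> is_lim_seq (psum a) (Series a).
Proof. intro H. apply is_series_psum, Series_correct, H. Qed.

Lemma psum_ext (a b : nat -> R) (N : nat) :
  (forall n, (n < N)%nat -> a n = b n) -> psum a N = psum b N.
Proof.
  induction N as [|N IH]; intro H; simpl; [reflexivity|].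
  rewrite H, IH; auto with arith.
Qed.

Lemma psum_le (a b : nat -> R) (N : nat) :
  (forall n, (n < N)%nat -> a n <= b n) -> psum a N <= psum b N.
Proof.
  induction N as [|N IH]; intro H; simpl; [lra|].
  apply Rplus_le_compat; auto with arith.
Qed.

Lemma psum_lin (c d : R) (a b : nat -> R) (N : nat) :
  psum (fun n => c * a n + d * b n) N = c * psum a N + d * psum b N.
Proof. induction N as [|N IH]; simpl; [|rewrite IH]; ring. Qed.

Lemma psum_const (c : R) (N : nat) : psum (fun _ => c) N = INR N * c.
Proof. induction N as [|N IH]; [simpl; ring|]. rewrite S_INR. simpl. rewrite IH. ring. Qed.

Lemma psum_swap (f : nat -> nat -> R) (N K : nat) :
  psum (fun n => psum (f n) K) N = psum (fun k => psum (fun n => f n k) N) K.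
Proof.
  induction N as [|N IH]; simpl.
  - rewrite psum_const. ring.
  - rewrite IH.
    pose proof (psum_lin 1 1 (fun k => psum (fun n => f n k) N) (f N) K) as H.
    rewrite !Rmult_1_l in H. rewrite <- H.
    apply psum_ext. intros k _. simpl. ring.
Qed.

Lemma is_lim_seq_psum (f : nat -> nat -> R) (l : nat -> R) (K : nat) :
  (forall k, is_lim_seq (fun n => f n k) (l k)) ->
  is_lim_seq (fun n => psum (f n) K) (psum l K).
Proof.
  intro H. induction K as [|K IH]; simpl.
  - apply is_lim_seq_const.
  - apply (is_lim_seq_plus' _ _ _ _ IH (H K)).
Qed.

Lemma is_lim_seq_le_const (a : nat -> R) (l C : R) :
  (forall n, a n <= C) -> is_lim_seq a l -> l <= C.
Proof.
  intros H Ha.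
  exact (is_lim_seq_le a (fun _ => C) l C H Ha (is_lim_seq_const C)).
Qed.

Lemma ex_series_bounded (a : nat -> R) (C : R) :
  (forall n, 0 <= a n) -> (forall N, psum a N <= C) -> ex_series a /\ Series a <= C.
Proof.
  intros Ha HC.
  assert (Hf : ex_finite_lim_seq (psum a)).
  { apply ex_finite_lim_seq_incr with C; [|exact HC].
    intro n. simpl. specialize (Ha n). lra. }
  destruct Hf as [l Hl].
  split.
  - exists l. apply is_series_psum, Hl.
  - replace (Series a) with l.
    + apply is_lim_seq_le_const with (psum a); assumption.
    + symmetry. apply is_series_unique, is_series_psum, Hl.
Qed.

Lemma psum_le_Series (a : nat -> R) (N : nat) :
  (forall n, 0 <= a n) -> ex_series a -> psum a N <= Series a.
Proof.
  intros Ha Hs.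
  apply (is_lim_seq_incr_compare (psum a)).
  - apply Series_psum, Hs.
  - intro n. simpl. specialize (Ha n). lra.
Qed.

Lemma Series_nonneg (a : nat -> R) : (forall n, 0 <= a n) -> ex_series a -> 0 <= Series a.
Proof. intros Ha Hs. exact (psum_le_Series a 0 Ha Hs). Qed.

Lemma term_le_Series (a : nat -> R) (k : nat) :
  (forall n, 0 <= a n) -> ex_series a -> a k <= Series a.
Proof.
  intros Ha Hs. apply Rle_trans with (psum a (S k)).
  - simpl. enough (0 <= psum a k) by lra.
    rewrite <- (Rmult_0_r (INR k)), <- psum_const. apply psum_le. auto.
  - apply psum_le_Series; assumption.
Qed.

Lemma Series_eq_0_term (a : nat -> R) (k : nat) :
  (forall n, 0 <= a n) -> ex_series a -> Series a <= 0 -> a k = 0.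
Proof.
  intros Ha Hs H0. pose proof (term_le_Series a k Ha Hs). specialize (Ha k). lra.
Qed.

Lemma ex_series_dominated (a b : nat -> R) :
  (forall n, Rabs (a n) <= b n) -> ex_series b -> ex_series a.
Proof. intros H Hb. exact (ex_series_le a b H Hb). Qed.

Lemma ex_series_mult_l (c : R) (a : nat -> R) :
  ex_series a -> ex_series (fun n => c * a n).
Proof. exact (ex_series_scal c a). Qed.

Lemma is_series_lin (c d : R) (a b : nat -> R) (la lb : R) :
  is_series a la -> is_series b lb ->
  is_series (fun n => c * a n + d * b n) (c * la + d * lb).
Proof.
  intros Ha Hb.
  apply (is_series_plus (fun n => c * a n) (fun n => d * b n)).
  - exact (is_series_scal c a la Ha).
  - exact (is_series_scal d b lb Hb).
Qed.

Lemma ex_series_lin (c d : R) (a b : nat -> R) :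
  ex_series a -> ex_series b -> ex_series (fun n => c * a n + d * b n).
Proof.
  intros [la Ha] [lb Hb]. eexists. apply is_series_lin; eassumption.
Qed.

Lemma Series_lin (c d : R) (a b : nat -> R) :
  ex_series a -> ex_series b ->
  Series (fun n => c * a n + d * b n) = c * Series a + d * Series b.
Proof.
  intros Ha Hb. apply is_series_unique, is_series_lin; apply Series_correct; assumption.
Qed.

Lemma Series_abs_le (a b : nat -> R) :
  (forall n, Rabs (a n) <= b n) -> ex_series b -> Rabs (Series a) <= Series b.
Proof.
  intros H Hb.
  assert (Hab : ex_series (fun n => Rabs (a n))).
  { apply (ex_series_dominated _ b); [|exact Hb]. intro n. rewrite Rabs_Rabsolu. apply H. }
  apply Rle_trans with (1 := Series_Rabs a Hab).
  apply Series_le; [|exact Hb]. intro n. split; [apply Rabs_pos | apply H].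
Qed.

Lemma is_series_single (a : nat -> R) (k : nat) :
  (forall n, n <> k -> a n = 0) -> is_series a (a k).
Proof.
  intro H. apply is_series_psum.
  assert (Hp : forall n, psum a (n + S k) = a k).
  { induction n as [|n IH]; simpl.
    - rewrite (psum_ext a (fun _ => 0)) by (intros; apply H; lia).
      rewrite psum_const. ring.
    - rewrite IH, (H (n + S k)%nat) by lia. ring. }
  apply (is_lim_seq_incr_n _ (S k)).
  apply is_lim_seq_ext with (fun _ => a k); [|apply is_lim_seq_const].
  intro n. symmetry. apply Hp.
Qed.

Lemma Series_tail_lim (a : nat -> R) :
  ex_series a -> is_lim_seq (fun N => Series (fun n => a (N + n)%nat)) 0.
Proof.
  intro Ha.
  apply is_lim_seq_incr_1.
  apply is_lim_seq_ext with (fun N => Series a - psum a (S N)).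
  - intro N. rewrite (Series_incr_n a (S N)) by (auto with arith). 
    rewrite <- sum_n_Reals, psum_sum_n. simpl pred. ring.
  - replace (Finite 0) with (Finite (Series a - Series a)) by (f_equal; ring).
    apply is_lim_seq_minus'; [apply is_lim_seq_const|].
    apply (is_lim_seq_incr_1 (psum a)), Series_psum, Ha.
Qed.

(** Dominated convergence with majorant [C * u]: a small tail of [u] handles the large indices, and
    the finitely many other terms tend to zero one by one. *)
Lemma Series_dominated_lim (u : nat -> R) (g : nat -> nat -> R) (C : R) :
  (forall j, 0 <= u j) -> ex_series u ->
  (forall m j, Rabs (g m j) <= C) -> (forall j, is_lim_seq (fun m => g m j) 0) ->
  is_lim_seq (fun m => Series (fun j => u j * Rabs (g m j))) 0.
Proof.
  intros Hu Hs HC Hg.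
  assert (HC0 : 0 <= C) by (apply Rle_trans with (2 := HC O O); apply Rabs_pos).
  assert (Hex : forall m, ex_series (fun j => u j * Rabs (g m j))).
  { intro m. apply (ex_series_dominated _ (fun j => C * u j)).
    - intro j. rewrite Rabs_mult, Rabs_Rabsolu, (Rabs_pos_eq (u j)) by apply Hu.
      rewrite Rmult_comm. apply Rmult_le_compat_r; auto.
    - exact (ex_series_mult_l C u Hs). }
  apply is_lim_seq_spec. intros eps. simpl.
  assert (Ht := Series_tail_lim u Hs). apply is_lim_seq_spec in Ht.
  (* [C + 1] instead of [C] keeps the divisor positive when [C = 0]. *)
  assert (He : 0 < eps / (2 * (C + 1))).
  { apply Rdiv_lt_0_compat; [apply eps | lra]. }
  destruct (Ht (mkposreal _ He)) as [N0 HN0].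
  assert (HN : exists N, (0 < N)%nat /\
    Rabs (Series (fun n => u (N + n)%nat)) < eps / (2 * (C + 1))).
  { exists (S N0). split; [lia|].
    specialize (HN0 (S N0) (le_S _ _ (le_n _))). rewrite Rminus_0_r in HN0. exact HN0. }
  clear N0 HN0. destruct HN as [[|N] [HN0 HN]]; [lia|].
  assert (Hp : is_lim_seq (fun m => psum (fun j => u j * Rabs (g m j)) (S N))
                 (psum (fun _ => 0) (S N))).
  { apply is_lim_seq_psum. intro j.
    replace (Finite 0) with (Finite (u j * 0)) by (f_equal; ring).
    apply (is_lim_seq_scal_l _ (u j) 0).
    rewrite <- Rabs_R0. apply (is_lim_seq_abs _ 0), Hg. }
  rewrite psum_const, Rmult_0_r in Hp.
  apply is_lim_seq_spec in Hp.
  assert (He2 : 0 < eps / 2) by (pose proof (cond_pos eps); lra).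
  destruct (Hp (mkposreal _ He2)) as [K HK].
  exists K. intros m Hm. specialize (HK m Hm). simpl in HK.
  rewrite Rminus_0_r in *.
  rewrite (Series_incr_n _ (S N)) by (auto with arith).
  rewrite <- sum_n_Reals, <- psum_sum_n. simpl Nat.pred.
  apply Rle_lt_trans with (1 := Rabs_triang _ _).
  apply Rlt_le_trans with (eps / 2 + eps / 2); [|lra].
  apply Rplus_lt_le_compat; [exact HK|].
  apply Rle_trans with (Series (fun k => C * u (S N + k)%nat)).
  - apply Series_abs_le.
    + intro j. rewrite Rabs_mult, Rabs_Rabsolu, (Rabs_pos_eq (u _)) by apply Hu.
      rewrite Rmult_comm. apply Rmult_le_compat_r; auto.
    + apply (ex_series_mult_l C (fun k => u (S N + k)%nat)).
      apply (ex_series_incr_n u (S N)), Hs.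
  - rewrite Series_scal_l.
    apply Rle_trans with ((C + 1) * (eps / (2 * (C + 1)))); [|right; field; lra].
    apply Rmult_le_compat; try lra.
    + apply Series_nonneg; [auto|]. apply (ex_series_incr_n u (S N)), Hs.
    + apply Rle_trans with (1 := Rle_abs _). lra.
Qed.

(** * Real square-summable sequences *)

Definition ell2 (x : nat -> R) : Prop := ex_series (fun n => x n ^ 2).
Definition dot (x y : nat -> R) : R := Series (fun n => x n * y n).
Definition nrm (x : nat -> R) : R := sqrt (dot x x).
(** One form covers sums, differences and multiples, and also the real and imaginary parts of a
    complex multiple, each of which mixes both parts of the vector. *)
Definition lin (a : R) (x : nat -> R) (b : R) (y : nat -> R) : nat -> R :=
  fun n => a * x n + b * y n.
Definition delta (j : nat) : nat -> R := fun n => if Nat.eqb n j then 1 else 0.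

Lemma ex_dot (x y : nat -> R) : ell2 x -> ell2 y -> ex_series (fun n => x n * y n).
Proof.
  intros Hx Hy.
  apply (ex_series_dominated _ (fun n => 1 * x n ^ 2 + 1 * y n ^ 2)).
  - intro n. apply Rabs_le. nra.
  - apply ex_series_lin; assumption.
Qed.

Lemma ell2_lin (a b : R) (x y : nat -> R) : ell2 x -> ell2 y -> ell2 (lin a x b y).
Proof.
  intros Hx Hy.
  apply (ex_series_dominated _ (fun n => 2 * a ^ 2 * x n ^ 2 + 2 * b ^ 2 * y n ^ 2)).
  - intro n. unfold lin. rewrite Rabs_pos_eq by apply pow2_ge_0.
    pose proof (pow2_ge_0 (a * x n - b * y n)). nra.
  - apply ex_series_lin; assumption.
Qed.

Lemma lin_0_r (a : R) (x : nat -> R) : (fun n => a * x n) = lin a x 0 x.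
Proof. apply functional_extensionality. intro n. unfold lin. ring. Qed.

Lemma ell2_scal (a : R) (x : nat -> R) : ell2 x -> ell2 (fun n => a * x n).
Proof. intro H. rewrite lin_0_r. apply ell2_lin; assumption. Qed.

Lemma ell2_0 : ell2 (fun _ => 0).
Proof.
  eexists. apply (is_series_single _ 0). intros. ring.
Qed.

Lemma dot_comm (x y : nat -> R) : dot x y = dot y x.
Proof. apply Series_ext. intro n. apply Rmult_comm. Qed.

Lemma dot_lin_l (a b : R) (x y z : nat -> R) :
  ell2 x -> ell2 y -> ell2 z -> dot (lin a x b y) z = a * dot x z + b * dot y z.
Proof.
  intros Hx Hy Hz. unfold dot.
  rewrite <- Series_lin by (apply ex_dot; assumption).
  apply Series_ext. intro n. unfold lin. ring.
Qed.

Lemma dot_lin_r (a b : R) (x y z : nat -> R) :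
  ell2 x -> ell2 y -> ell2 z -> dot z (lin a x b y) = a * dot z x + b * dot z y.
Proof. intros. rewrite !(dot_comm z), dot_lin_l by assumption. reflexivity. Qed.

Lemma dot_scal_l (a : R) (x y : nat -> R) : dot (fun n => a * x n) y = a * dot x y.
Proof.
  unfold dot. rewrite <- Series_scal_l. apply Series_ext. intro n. ring.
Qed.

Lemma dot_scal_r (a : R) (x y : nat -> R) : dot x (fun n => a * y n) = a * dot x y.
Proof. rewrite dot_comm, dot_scal_l, dot_comm. reflexivity. Qed.

Lemma dot_0_l (y : nat -> R) : dot (fun _ => 0) y = 0.
Proof.
  pose proof (dot_scal_l 0 (fun _ => 0) y) as H. rewrite Rmult_0_l in H.
  apply eq_trans with (2 := H). apply Series_ext. intro n. ring.
Qed.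

Lemma dot_0_r (y : nat -> R) : dot y (fun _ => 0) = 0.
Proof. rewrite dot_comm. apply dot_0_l. Qed.

Lemma dot_sq (x : nat -> R) : dot x x = Series (fun n => x n ^ 2).
Proof. apply Series_ext. intro n. ring. Qed.

Lemma dot_ge_0 (x : nat -> R) : ell2 x -> 0 <= dot x x.
Proof.
  intro H. rewrite dot_sq. apply Series_nonneg; [|exact H]. intro n. apply pow2_ge_0.
Qed.

Lemma dot_eq_0 (x : nat -> R) : ell2 x -> dot x x <= 0 -> forall n, x n = 0.
Proof.
  intros H H0 n. rewrite dot_sq in H0.
  apply (Series_eq_0_term (fun n => x n ^ 2) n (fun n => pow2_ge_0 (x n)) H) in H0. nra.
Qed.

Lemma dot_nonzero (x : nat -> R) (n : nat) : ell2 x -> x n <> 0 -> 0 < dot x x.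
Proof.
  intros H Hn. destruct (Rle_or_lt (dot x x) 0) as [H0|H0]; [|exact H0].
  destruct Hn. apply dot_eq_0; assumption.
Qed.

Lemma cauchy_schwarz (x y : nat -> R) :
  ell2 x -> ell2 y -> dot x y ^ 2 <= dot x x * dot y y.
Proof.
  intros Hx Hy.
  destruct (Rle_or_lt (dot y y) 0) as [H0|H0].
  - assert (dot x y = 0).
    { unfold dot. rewrite (Series_ext _ (fun n => 0 * 0)).
      - rewrite Series_scal_l. ring.
      - intro n. rewrite (dot_eq_0 y Hy H0 n). ring. }
    pose proof (dot_ge_0 y Hy). pose proof (dot_ge_0 x Hx). nra.
  (* The square norm of [<y,y> x - <x,y> y] expands to [<y,y> (<x,x> <y,y> - <x,y>^2)]. *)
  - pose proof (dot_ge_0 _ (ell2_lin (dot y y) (- dot x y) x y Hx Hy)) as H.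
    rewrite dot_lin_l, !dot_lin_r in H by (try apply ell2_lin; assumption).
    rewrite (dot_comm y x) in H.
    apply Rmult_le_reg_l with (dot y y); [exact H0|]. nra.
Qed.

Lemma nrm_ge_0 (x : nat -> R) : 0 <= nrm x.
Proof. apply sqrt_pos. Qed.

Lemma nrm_sq (x : nat -> R) : ell2 x -> nrm x ^ 2 = dot x x.
Proof. intro H. apply pow2_sqrt, dot_ge_0, H. Qed.

Lemma nrm_le (x : nat -> R) (C : R) : 0 <= C -> dot x x <= C ^ 2 -> nrm x <= C.
Proof.
  intros HC H. unfold nrm. rewrite <- (sqrt_pow2 C HC). apply sqrt_le_1_alt, H.
Qed.

Lemma dot_abs_le (x y : nat -> R) : ell2 x -> ell2 y -> Rabs (dot x y) <= nrm x * nrm y.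
Proof.
  intros Hx Hy. rewrite <- sqrt_Rsqr_abs. unfold nrm.
  rewrite <- sqrt_mult by (apply dot_ge_0; assumption).
  apply sqrt_le_1_alt. rewrite Rsqr_pow2. apply cauchy_schwarz; assumption.
Qed.

Lemma nrm_lin (a b : R) (x y : nat -> R) :
  ell2 x -> ell2 y -> nrm (lin a x b y) <= Rabs a * nrm x + Rabs b * nrm y.
Proof.
  intros Hx Hy. pose proof (nrm_ge_0 x). pose proof (nrm_ge_0 y).
  pose proof (Rabs_pos a). pose proof (Rabs_pos b).
  apply nrm_le; [nra|].
  rewrite dot_lin_l, !dot_lin_r by (try apply ell2_lin; assumption).
  rewrite (dot_comm y x), <- !nrm_sq by assumption.
  pose proof (dot_abs_le x y Hx Hy) as Hd.
  assert (a * b * dot x y <= Rabs a * Rabs b * (nrm x * nrm y)).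
  { apply Rle_trans with (1 := Rle_abs _). rewrite !Rabs_mult.
    apply Rmult_le_compat_l; [nra|exact Hd]. }
  assert (Ha : Rabs a ^ 2 = a ^ 2) by apply pow2_abs.
  assert (Hb : Rabs b ^ 2 = b ^ 2) by apply pow2_abs.
  replace ((Rabs a * nrm x + Rabs b * nrm y) ^ 2) with
    (Rabs a ^ 2 * nrm x ^ 2 + 2 * (Rabs a * Rabs b * (nrm x * nrm y))
     + Rabs b ^ 2 * nrm y ^ 2) by ring.
  rewrite Ha, Hb. nra.
Qed.

Lemma nrm_scal (a : R) (x : nat -> R) : nrm (fun n => a * x n) = Rabs a * nrm x.
Proof.
  unfold nrm. rewrite dot_scal_l, dot_scal_r, <- Rmult_assoc.
  rewrite <- sqrt_Rsqr_abs. apply sqrt_mult_alt, Rle_0_sqr.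
Qed.

Lemma coord_le_nrm (x : nat -> R) (n : nat) : ell2 x -> Rabs (x n) <= nrm x.
Proof.
  intro H. rewrite <- sqrt_Rsqr_abs. apply sqrt_le_1_alt.
  rewrite Rsqr_pow2, dot_sq.
  exact (term_le_Series (fun n => x n ^ 2) n (fun n => pow2_ge_0 (x n)) H).
Qed.

Lemma ell2_delta (j : nat) : ell2 (delta j).
Proof.
  eexists. apply (is_series_single _ j). intros n Hn. unfold delta.
  rewrite (proj2 (Nat.eqb_neq n j) Hn). ring.
Qed.

Lemma dot_delta (x : nat -> R) (j : nat) : dot x (delta j) = x j.
Proof.
  apply is_series_unique.
  replace (x j) with (x j * delta j j) by (unfold delta; rewrite Nat.eqb_refl; ring).
  apply (is_series_single (fun n => x n * delta j n)).
  intros n Hn. unfold delta. rewrite (proj2 (Nat.eqb_neq n j) Hn). ring.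
Qed.

Lemma nrm_lim_dot (z : nat -> nat -> R) (y b : nat -> R) :
  (forall m, ell2 (z m)) -> ell2 y -> ell2 b ->
  is_lim_seq (fun m => nrm (lin 1 (z m) (-1) y)) 0 ->
  is_lim_seq (fun m => dot (z m) b) (dot y b).
Proof.
  intros Hz Hy Hb H.
  apply is_lim_seq_ext with (fun m => dot (lin 1 (z m) (-1) y) b + dot y b).
  { intro m. rewrite dot_lin_l by auto. ring. }
  rewrite <- (Rplus_0_l (dot y b)) at 1.
  apply is_lim_seq_plus'; [|apply is_lim_seq_const].
  apply is_lim_seq_abs_0.
  apply is_lim_seq_le_le with (fun _ => 0) (fun m => nrm (lin 1 (z m) (-1) y) * nrm b).
  - intro m. split; [apply Rabs_pos|]. apply dot_abs_le; [apply ell2_lin; auto|exact Hb].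
  - apply is_lim_seq_const.
  - rewrite <- (Rmult_0_l (nrm b)).
    apply (is_lim_seq_mult' _ _ _ _ H (is_lim_seq_const _)).
Qed.

(** * Absolutely convergent series of vectors *)

Definition vsum (v : nat -> nat -> R) (N : nat) : nat -> R :=
  fun i => psum (fun n => v n i) N.

Lemma vsum_S (v : nat -> nat -> R) (N : nat) : vsum v (S N) = lin 1 (vsum v N) 1 (v N).
Proof. apply functional_extensionality. intro i. unfold vsum, lin. simpl. ring. Qed.

Lemma ell2_vsum (v : nat -> nat -> R) (N : nat) : (forall n, ell2 (v n)) -> ell2 (vsum v N).
Proof.
  intro Hv. induction N as [|N IH]; [exact ell2_0|].
  rewrite vsum_S. apply ell2_lin; auto.
Qed.

Lemma nrm_vsum (v : nat -> nat -> R) (N : nat) :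
  (forall n, ell2 (v n)) -> nrm (vsum v N) <= psum (fun n => nrm (v n)) N.
Proof.
  intro Hv. induction N as [|N IH].
  - unfold nrm. change (vsum v 0) with (fun _ : nat => 0).
    rewrite dot_0_l, sqrt_0. simpl. lra.
  - rewrite vsum_S. simpl.
    apply Rle_trans with (1 := nrm_lin 1 1 _ _ (ell2_vsum v N Hv) (Hv N)).
    rewrite Rabs_R1. lra.
Qed.

Lemma dot_vsum (v : nat -> nat -> R) (y : nat -> R) (N : nat) :
  (forall n, ell2 (v n)) -> ell2 y -> dot (vsum v N) y = psum (fun n => dot (v n) y) N.
Proof.
  intros Hv Hy. induction N as [|N IH].
  - exact (dot_0_l y).
  - rewrite vsum_S, dot_lin_l by (auto using ell2_vsum). rewrite IH. simpl. ring.
Qed.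

Section AbsolutelyConvergent.
Context (v : nat -> nat -> R).
Context (Hv : forall n, ell2 (v n)).
Context (Hs : ex_series (fun n => nrm (v n))).

Lemma ex_vseries (i : nat) : ex_series (fun n => v n i).
Proof.
  apply (ex_series_dominated _ (fun n => nrm (v n))); [|exact Hs].
  intro n. apply coord_le_nrm, Hv.
Qed.

(** A Fatou argument that needs no completeness of the space: the sum exists coordinatewise, and the
    bound on the first [K] squares passes from the partial sums to the limit. *)
Lemma vseries_bound :
  ell2 (fun i => Series (fun n => v n i)) /\
  nrm (fun i => Series (fun n => v n i)) <= Series (fun n => nrm (v n)).
Proof.
  assert (H0 : 0 <= Series (fun n => nrm (v n))).
  { apply Series_nonneg; [intro; apply nrm_ge_0 | exact Hs]. }
  destruct (ex_series_bounded (fun i => Series (fun n => v n i) ^ 2)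
              (Series (fun n => nrm (v n)) ^ 2)) as [H1 H2].
  - intro i. apply pow2_ge_0.
  - intro K.
    apply is_lim_seq_le_const with (fun N => psum (fun i => vsum v N i ^ 2) K).
    + intro N. apply Rle_trans with (nrm (vsum v N) ^ 2).
      * rewrite nrm_sq, dot_sq by (apply ell2_vsum, Hv).
        apply psum_le_Series; [intro; apply pow2_ge_0 | apply ell2_vsum, Hv].
      * apply pow_incr. split; [apply nrm_ge_0|].
        apply Rle_trans with (1 := nrm_vsum v N Hv).
        apply psum_le_Series; [intro; apply nrm_ge_0 | exact Hs].
    + apply (is_lim_seq_psum (fun N i => vsum v N i ^ 2)). intro i.
      assert (Hl := Series_psum _ (ex_vseries i)).
      simpl. apply (is_lim_seq_mult' _ _ _ _ Hl).
      apply (is_lim_seq_mult' _ _ _ _ Hl (is_lim_seq_const 1)).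
  - split; [exact H1|]. apply nrm_le; [exact H0|]. rewrite dot_sq. exact H2.
Qed.

End AbsolutelyConvergent.

Lemma vseries_dot (v : nat -> nat -> R) (y : nat -> R) :
  (forall n, ell2 (v n)) -> ex_series (fun n => nrm (v n)) -> ell2 y ->
  is_series (fun n => dot (v n) y) (dot (fun i => Series (fun n => v n i)) y).
Proof.
  intros Hv Hs Hy.
  destruct (vseries_bound v Hv Hs) as [Hw _].
  apply is_series_psum.
  apply is_lim_seq_ext with (fun N => dot (vsum v N) y).
  { intro N. apply dot_vsum; assumption. }
  apply nrm_lim_dot; auto using ell2_vsum.
  apply is_lim_seq_le_le with (fun _ => 0) (fun N => Series (fun n => nrm (v (N + n)%nat))).
  - intro N. split; [apply nrm_ge_0|].
    assert (Hs' : ex_series (fun n => nrm (v (N + n)%nat))).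
    { apply (ex_series_incr_n (fun n => nrm (v n)) N), Hs. }
    destruct (vseries_bound (fun n => v (N + n)%nat) (fun n => Hv _) Hs') as [_ Hb].
    apply Rle_trans with (2 := Hb). right.
    (* The error of the [N]-th partial sum is minus the series of the shifted vectors, to which
       [vseries_bound] applies again. [N = 0] is separate because [Series_incr_n] splits off a
       positive number of terms. *)
    assert (E : lin 1 (vsum v N) (-1) (fun i => Series (fun n => v n i))
                = fun i => -1 * Series (fun n => v (N + n)%nat i)).
    { apply functional_extensionality. intro i. unfold lin, vsum.
      destruct N as [|N].
      - simpl. ring.
      - rewrite (Series_incr_n (fun n => v n i) (S N)) by (auto using ex_vseries with arith).
        rewrite <- sum_n_Reals, <- psum_sum_n. simpl Nat.pred. ring. }
    rewrite E, nrm_scal, Rabs_m1. ring.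
  - apply is_lim_seq_const.
  - apply (Series_tail_lim (fun n => nrm (v n)) Hs).
Qed.

(** * Orthogonal systems *)

(* Zero vectors are allowed, so that the normalised images [A e / |A e|], set to
   [0] where [A e = 0], form such a system. *)
Definition orthosys (f : nat -> nat -> R) (N : nat) : Prop :=
  (forall n, (n < N)%nat -> ell2 (f n)) /\
  (forall m n, (m < N)%nat -> (n < N)%nat -> m <> n -> dot (f m) (f n) = 0) /\
  (forall n, (n < N)%nat -> dot (f n) (f n) = 1 \/ dot (f n) (f n) = 0).

(** Projections are subtracted one at a time: after [K] steps the residual is orthogonal to the
    first [K] vectors and still has the inner products of [x] with the others. *)
Lemma orthosys_residual (f : nat -> nat -> R) (N : nat) (x : nat -> R) :
  orthosys f N -> ell2 x ->
  exists r, ell2 r /\ (forall n, (n < N)%nat -> dot r (f n) = 0) /\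
    dot r r = dot x x - psum (fun n => dot x (f n) ^ 2) N.
Proof.
  intros (Hf & Ho & H1) Hx.
  enough (H : forall K, (K <= N)%nat ->
    exists r, ell2 r /\
      (forall n, (n < N)%nat -> dot r (f n) = if Nat.ltb n K then 0 else dot x (f n)) /\
      dot r r = dot x x - psum (fun n => dot x (f n) ^ 2) K).
  { destruct (H N (le_n N)) as (r & Hr & H2 & H3). exists r. split; [exact Hr|].
    split; [|exact H3]. intros n Hn. rewrite H2 by exact Hn.
    rewrite (proj2 (Nat.ltb_lt n N) Hn). reflexivity. }
  induction K as [|K IH]; intro HK.
  - exists x. split; [exact Hx|]. split; [reflexivity|]. simpl. ring.
  - destruct IH as (r & Hr & H2 & H3); [lia|].
    assert (HKN : (K < N)%nat) by lia.
    (* This equation treats unit and zero vectors alike: if [f K] has norm zero, Cauchy-Schwarz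
       makes the coefficient vanish as well. *)
    assert (Hc : dot x (f K) * dot (f K) (f K) = dot x (f K)).
    { destruct (H1 K HKN) as [E|E]; rewrite E; [ring|].
      pose proof (cauchy_schwarz x (f K) Hx (Hf K HKN)) as H. rewrite E in H. nra. }
    pose proof (H2 K HKN) as HrK. rewrite Nat.ltb_irrefl in HrK.
    exists (lin 1 r (- dot x (f K)) (f K)).
    split; [apply ell2_lin; auto|]. split.
    + intros n Hn. rewrite dot_lin_l by auto. rewrite H2 by exact Hn.
      destruct (Nat.eq_dec n K) as [->|Hne].
      * rewrite Nat.ltb_irrefl, (proj2 (Nat.ltb_lt K (S K)) (le_n _)). lra.
      * rewrite (Ho K n) by auto.
        replace (Nat.ltb n (S K)) with (Nat.ltb n K); [ring|].
        destruct (Nat.ltb_spec n K), (Nat.ltb_spec n (S K)); auto; lia.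
    + rewrite dot_lin_l, !dot_lin_r by (try apply ell2_lin; auto).
      rewrite (dot_comm (f K) r), HrK, H3. cbn [psum].
      set (a := dot x (f K)) in *.
      transitivity (dot x x - psum (fun n => dot x (f n) ^ 2) K - 2 * a * a
                    + a * (a * dot (f K) (f K))); [ring|].
      rewrite Hc. ring.
Qed.

Lemma bessel (f : nat -> nat -> R) (N : nat) (x : nat -> R) :
  orthosys f N -> ell2 x -> psum (fun n => dot x (f n) ^ 2) N <= dot x x.
Proof.
  intros Hf Hx. destruct (orthosys_residual f N x Hf Hx) as (r & Hr & _ & H).
  pose proof (dot_ge_0 r Hr). lra.
Qed.

(** Bessel's inequality for the coordinate vector [delta j], whose coefficients are the [j]-th
    coordinates of the system. *)
Lemma bessel_coord (f : nat -> nat -> R) (N j : nat) :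
  orthosys f N -> psum (fun n => f n j ^ 2) N <= 1.
Proof.
  intro Hf. pose proof (bessel f N (delta j) Hf (ell2_delta j)) as H.
  rewrite dot_delta in H. unfold delta at 2 in H. rewrite Nat.eqb_refl in H.
  rewrite (psum_ext _ (fun n => dot (delta j) (f n) ^ 2)); [exact H|].
  intros n _. rewrite dot_comm, dot_delta. reflexivity.
Qed.

Lemma ex_weighted (u x : nat -> R) :
  (forall j, 0 <= u j) -> ex_series u -> ell2 x -> ex_series (fun j => u j * x j ^ 2).
Proof.
  intros Hu Hs Hx. apply (ex_series_dominated _ (fun j => nrm x ^ 2 * u j)).
  - intro j. rewrite Rabs_mult, (Rabs_pos_eq (u j)), Rmult_comm by apply Hu.
    apply Rmult_le_compat_r; [apply Hu|].
    rewrite <- RPow_abs. apply pow_incr. split; [apply Rabs_pos|].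
    apply coord_le_nrm, Hx.
  - exact (ex_series_mult_l _ u Hs).
Qed.

(** Once the sums over [n] and [j] are exchanged, each [u j] is multiplied by a factor at most [1]
    by [bessel_coord]. The sum over [n] is finite, so the exchange is an induction. *)
Lemma bessel_weighted (u : nat -> R) (f : nat -> nat -> R) (N : nat) :
  (forall j, 0 <= u j) -> ex_series u -> orthosys f N ->
  psum (fun n => Series (fun j => u j * f n j ^ 2)) N <= Series u.
Proof.
  intros Hu Hs Hf.
  assert (H : forall K, (K <= N)%nat ->
    is_series (fun j => u j * psum (fun n => f n j ^ 2) K)
      (psum (fun n => Series (fun j => u j * f n j ^ 2)) K)).
  { induction K as [|K IH]; intro HK.
    - simpl. pose proof (is_series_single (fun j => u j * 0) 0) as H.
      cbv beta in H. rewrite Rmult_0_r in H. apply H. intros. ring.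
    - assert (HfK : ell2 (f K)) by (apply Hf; lia).
      assert (IH' := is_series_lin 1 1 _ _ _ _ (IH (ltac:(lia) : (K <= N)%nat))
                       (Series_correct _ (ex_weighted u (f K) Hu Hs HfK))).
      simpl psum. rewrite !Rmult_1_l in IH'.
      apply (is_series_ext) with (2 := IH'). intro j. simpl. ring. }
  specialize (H N (le_n N)). rewrite <- (is_series_unique _ _ H).
  apply Series_le; [|exact Hs]. intro j.
  assert (0 <= psum (fun n => f n j ^ 2) N).
  { rewrite <- (Rmult_0_r (INR N)), <- psum_const. apply psum_le.
    intros n _. apply pow2_ge_0. }
  pose proof (bessel_coord f N j Hf). specialize (Hu j). split; nra.
Qed.

Lemma orthosys_complement (f : nat -> nat -> R) (N : nat) :
  orthosys f N -> exists r, ell2 r /\ (forall n, (n < N)%nat -> dot r (f n) = 0) /\ 0 < dot r r.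
Proof.
  intro Hf. apply NNPP. intro Hno.
  (* Otherwise each [delta j] lies in the span, so [1 = sum_n f n j ^ 2]; summing over
     [j <= N] contradicts [|f n| <= 1]. *)
  assert (H1 : forall j, psum (fun n => f n j ^ 2) N >= 1).
  { intro j. destruct (orthosys_residual f N (delta j) Hf (ell2_delta j)) as (r & Hr & H0 & H).
    assert (Hr0 : ~ 0 < dot r r) by (intro; apply Hno; exists r; auto).
    rewrite dot_delta in H. unfold delta at 1 in H. rewrite Nat.eqb_refl in H.
    rewrite (psum_ext _ (fun n => dot (delta j) (f n) ^ 2)); [lra|].
    intros n _. rewrite dot_comm, dot_delta. reflexivity. }
  assert (H2 : psum (fun j => psum (fun n => f n j ^ 2) N) (S N) >= INR (S N) * 1).
  { rewrite <- psum_const. apply Rle_ge, psum_le. intros j _. apply Rge_le, H1. }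
  rewrite <- (psum_swap (fun n j => f n j ^ 2)) in H2.
  assert (H3 : psum (fun n => psum (fun j => f n j ^ 2) (S N)) N <= INR N * 1).
  { rewrite <- psum_const. apply psum_le. intros n Hn.
    apply Rle_trans with (dot (f n) (f n)).
    - rewrite dot_sq. apply psum_le_Series; [intro; apply pow2_ge_0|]. apply Hf, Hn.
    - destruct Hf as (_ & _ & Hf). destruct (Hf n Hn) as [-> | ->]; lra. }
  rewrite S_INR in H2. lra.
Qed.

(** * Choosing sequences *)

(** Choice in which the [n]-th value may depend on all earlier ones. The first hypothesis says that
    [P n] sees only the values below [n]; hence the approximation [F n], filled with [t0] from [n]
    on, can stand in for the final [f]. *)
Lemma prefix_choice (T : Type) (t0 : T) (P : nat -> (nat -> T) -> T -> Prop) :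
  (forall n f g x, (forall k, (k < n)%nat -> f k = g k) -> P n f x -> P n g x) ->
  (forall n f, (forall k, (k < n)%nat -> P k f (f k)) -> exists x, P n f x) ->
  exists f, forall n, P n f (f n).
Proof.
  intros Hext Hstep.
  pose (next := fun n f => epsilon (inhabits t0) (P n f)).
  pose (F := fix F (n : nat) : nat -> T :=
    match n with
    | O => fun _ => t0
    | S m => fun k => if Nat.eqb k m then next m (F m) else F m k
    end).
  pose (f := fun n => F (S n) n).
  assert (HF : forall n k, (k < n)%nat -> F n k = f k).
  { induction n as [|n IH]; intros k Hk; [lia|].
    destruct (Nat.eq_dec k n) as [->|Hne]; [reflexivity|].
    simpl. rewrite (proj2 (Nat.eqb_neq k n) Hne). apply IH. lia. }
  exists f. intro n. induction n as [n IH] using (well_founded_induction lt_wf).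
  assert (Hf : f n = next n (F n)).
  { unfold f. simpl. rewrite Nat.eqb_refl. reflexivity. }
  apply Hext with (F n); [apply HF|].
  rewrite Hf. apply epsilon_spec.
  destruct (Hstep n f IH) as [x Hx].
  exists x. apply Hext with (2 := Hx). intros k Hk. symmetry. apply HF, Hk.
Qed.

(** The limit is built before the subsequence: [y n] is chosen so that arbitrarily late terms are
    close to [y] in all coordinates up to [n]. Afterwards [phi m] is an index at least [m] whose
    first [m] coordinates are within [1/(m+1)]. Nested subsequences are avoided. *)
Lemma pointwise_subsequence (x : nat -> nat -> R) :
  (forall k i, Rabs (x k i) <= 1) ->
  exists (phi : nat -> nat) (y : nat -> R),
    (forall m, (m <= phi m)%nat) /\ forall i, is_lim_seq (fun m => x (phi m) i) (y i).
Proof.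
  intro Hx.
  destruct (prefix_choice R 0 (fun n y t =>
    forall (eps : posreal) N, exists k, (N <= k)%nat /\ Rabs (x k n - t) < eps /\
      forall i, (i < n)%nat -> Rabs (x k i - y i) < eps)) as [y Hy].
  - intros n f g t Hfg H eps N. destruct (H eps N) as (k & Hk & H1 & H2).
    exists k. repeat split; auto. intros i Hi. rewrite <- Hfg by exact Hi. auto.
  - intros n y IH.
    assert (Hn : forall (eps : posreal) N, exists k, (N <= k)%nat /\
               forall i, (i < n)%nat -> Rabs (x k i - y i) < eps).
    { destruct n as [|n]; intros eps N.
      - exists N. split; [lia|]. intros i Hi. lia.
      - destruct (IH n (Nat.lt_succ_diag_r n) eps N) as (k & Hk & H1 & H2).
        exists k. split; [exact Hk|]. intros i Hi.
        destruct (Nat.eq_dec i n) as [->|Hne]; [exact H1|]. apply H2. lia. }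
    assert (Hpos : forall m, 0 < / (INR m + 1)) by (intro m; apply Rinv_0_lt_compat, INRp1_pos).
    destruct (choice (fun m k => (m <= k)%nat /\
        forall i, (i < n)%nat -> Rabs (x k i - y i) < / (INR m + 1))) as [ph Hph].
    { intro m. exact (Hn (mkposreal _ (Hpos m)) m). }
    (* The new coordinate is a cluster point along indices [ph m] at which the earlier coordinates
       already converge. *)
    destruct (Bolzano_Weierstrass (fun m => x (ph m) n) (fun r => -1 <= r <= 1)
                (compact_P3 (-1) 1)) as [t Ht].
    { intro m. apply Rabs_le_between, Hx. }
    exists t. intros eps N.
    destruct (archimed_cor1 eps (cond_pos eps)) as (K & HK & HK0).
    destruct (Ht (fun r => Rabs (r - t) < eps) (Nat.max N K)) as (m & Hm & Hr).
    { exists eps. intros r Hr. exact Hr. }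
    destruct (Hph m) as [H1 H2].
    exists (ph m). split; [lia|]. split; [exact Hr|].
    intros i Hi. apply Rlt_trans with (1 := H2 i Hi).
    apply Rle_lt_trans with (2 := HK).
    apply Rinv_le_contravar; [apply lt_0_INR; lia|].
    assert (INR K <= INR m) by (apply le_INR; lia). lra.
  - assert (Hpos : forall m, 0 < / (INR m + 1)) by (intro m; apply Rinv_0_lt_compat, INRp1_pos).
    destruct (choice (fun m k => (m <= k)%nat /\
        forall i, (i < m)%nat -> Rabs (x k i - y i) < / (INR m + 1))) as [ph Hph].
    { intro m. destruct (Hy m (mkposreal _ (Hpos m)) m) as (k & Hk & _ & H2).
      exists k. split; assumption. }
    exists ph, y. split; [intro m; apply Hph|].
    intro i. apply is_lim_seq_spec. intro eps.
    destruct (archimed_cor1 eps (cond_pos eps)) as (K & HK & HK0).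
    exists (Nat.max (S i) K). intros m Hm.
    destruct (Hph m) as [_ H2].
    apply Rlt_trans with (1 := H2 i ltac:(lia)).
    apply Rle_lt_trans with (2 := HK).
    apply Rinv_le_contravar; [apply lt_0_INR; lia|].
    assert (INR K <= INR m) by (apply le_INR; lia). lra.
Qed.

(** * Matrices dominated by a summable rank-one matrix *)

Definition mv (M : nat -> nat -> R) (x : nat -> R) : nat -> R :=
  fun i => Series (fun j => M i j * x j).
Definition tr (M : nat -> nat -> R) : nat -> nat -> R := fun i j => M j i.

Definition dominated (M : nat -> nat -> R) (u : nat -> R) : Prop :=
  (forall j, 0 <= u j) /\ ex_series u /\ forall i j, Rabs (M i j) <= u i * u j.

Lemma dominated_tr (M : nat -> nat -> R) (u : nat -> R) :
  dominated M u -> dominated (tr M) u.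
Proof.
  intros (H0 & Hs & H). split; [exact H0|]. split; [exact Hs|].
  intros i j. rewrite Rmult_comm. apply H.
Qed.

Section Dominated.
Context (M : nat -> nat -> R) (u : nat -> R).
Context (HM : dominated M u).

Let A := mv M.
Let At := mv (tr M).

Lemma ell2_weight : ell2 u.
Proof.
  destruct HM as (H0 & Hs & _).
  apply (ex_series_dominated _ (fun j => Series u * u j)).
  - intro j. rewrite Rabs_pos_eq by apply pow2_ge_0. simpl. rewrite Rmult_1_r.
    apply Rmult_le_compat_r; [apply H0|]. apply term_le_Series; assumption.
  - exact (ex_series_mult_l _ u Hs).
Qed.

Lemma ex_weight_abs (x : nat -> R) : ell2 x -> ex_series (fun j => u j * Rabs (x j)).
Proof.
  destruct HM as (H0 & Hs & _). intro Hx.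
  apply (ex_series_dominated _ (fun j => nrm x * u j)).
  - intro j. rewrite Rabs_mult, Rabs_Rabsolu, (Rabs_pos_eq (u j)), Rmult_comm by apply H0.
    apply Rmult_le_compat_r; [apply H0|]. apply coord_le_nrm, Hx.
  - exact (ex_series_mult_l _ u Hs).
Qed.

Lemma dominated_entry (x : nat -> R) (i j : nat) :
  Rabs (M i j * x j) <= u i * (u j * Rabs (x j)).
Proof.
  destruct HM as (_ & _ & H). rewrite Rabs_mult, <- Rmult_assoc.
  apply Rmult_le_compat_r; [apply Rabs_pos | apply H].
Qed.

Lemma ex_mv (x : nat -> R) (i : nat) : ell2 x -> ex_series (fun j => M i j * x j).
Proof.
  intro Hx. apply (ex_series_dominated _ _ (dominated_entry x i)).
  apply (ex_series_mult_l (u i)), ex_weight_abs, Hx.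
Qed.

Lemma weight_abs_ge_0 (x : nat -> R) : ell2 x -> 0 <= Series (fun j => u j * Rabs (x j)).
Proof.
  intro Hx. apply Series_nonneg; [|apply ex_weight_abs, Hx].
  intro j. apply Rmult_le_pos; [apply HM | apply Rabs_pos].
Qed.

Lemma mv_coord_le (x : nat -> R) (i : nat) :
  ell2 x -> Rabs (A x i) <= u i * Series (fun j => u j * Rabs (x j)).
Proof.
  intro Hx. unfold A, mv. rewrite <- Series_scal_l. apply Series_abs_le.
  - apply dominated_entry.
  - apply (ex_series_mult_l (u i)), ex_weight_abs, Hx.
Qed.

Lemma ell2_mv (x : nat -> R) : ell2 x -> ell2 (A x).
Proof.
  intro Hx.
  apply (ex_series_dominated _ (fun i => (Series (fun j => u j * Rabs (x j))) ^ 2 * u i ^ 2)).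
  - intro i. rewrite <- RPow_abs, <- Rpow_mult_distr. apply pow_incr.
    split; [apply Rabs_pos|]. rewrite Rmult_comm. apply mv_coord_le, Hx.
  - apply (ex_series_mult_l _ _ ell2_weight).
Qed.

(** The weighted sum on the right is finer than a multiple of [nrm x]: it tends to zero for bounded
    sequences that converge to zero coordinatewise, which a norm bound would not give. *)
Lemma nrm_mv_le (x : nat -> R) :
  ell2 x -> nrm (A x) <= nrm u * Series (fun j => u j * Rabs (x j)).
Proof.
  intro Hx. pose proof (weight_abs_ge_0 x Hx) as Hw.
  apply nrm_le.
  - apply Rmult_le_pos; [apply nrm_ge_0 | exact Hw].
  - rewrite Rpow_mult_distr, nrm_sq, !dot_sq, Rmult_comm, <- Series_scal_l by apply ell2_weight.
    apply Series_le.
    + intro i. split; [apply pow2_ge_0|].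
      rewrite <- pow2_abs, <- Rpow_mult_distr. apply pow_incr.
      split; [apply Rabs_pos|]. rewrite Rmult_comm. apply mv_coord_le, Hx.
    + apply (ex_series_mult_l _ _ ell2_weight).
Qed.

Lemma nrm_mv_bounded (x : nat -> R) : ell2 x -> nrm (A x) <= nrm u * Series u * nrm x.
Proof.
  intro Hx. apply Rle_trans with (1 := nrm_mv_le x Hx). rewrite Rmult_assoc.
  apply Rmult_le_compat_l; [apply nrm_ge_0|].
  destruct HM as (H0 & Hs & _).
  rewrite <- Series_scal_r. apply Series_le.
  - intro j. split; [apply Rmult_le_pos; [apply H0 | apply Rabs_pos]|].
    apply Rmult_le_compat_l; [apply H0 | apply coord_le_nrm, Hx].
  - apply ex_series_scal_r, Hs.
Qed.

Lemma mv_lin (a b : R) (x y : nat -> R) :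
  ell2 x -> ell2 y -> A (lin a x b y) = lin a (A x) b (A y).
Proof.
  intros Hx Hy. apply functional_extensionality. intro i. unfold A, mv, lin.
  rewrite <- Series_lin by (apply ex_mv; assumption).
  apply Series_ext. intro j. ring.
Qed.

Lemma mv_scal (c : R) (x : nat -> R) : A (fun i => c * x i) = fun i => c * A x i.
Proof.
  apply functional_extensionality. intro i. unfold A, mv.
  rewrite <- Series_scal_l. apply Series_ext. intro j. ring.
Qed.

(** The exchange of the double sum comes from viewing [A x] as a series of columns [x j * M i j].
    Column [j] contributes norm at most [nrm u * u j * Rabs (x j)], so [vseries_dot] applies. *)
Lemma dot_mv (x y : nat -> R) : ell2 x -> ell2 y -> dot (A x) y = dot x (At y).
Proof.
  intros Hx Hy.
  assert (Hc : forall j, ell2 (fun i => M i j)).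
  { intro j. apply (ex_series_dominated _ (fun i => u j ^ 2 * u i ^ 2)).
    - intro i. rewrite <- RPow_abs, <- Rpow_mult_distr. apply pow_incr.
      split; [apply Rabs_pos|]. rewrite Rmult_comm. apply HM.
    - apply (ex_series_mult_l _ _ ell2_weight). }
  pose (v := fun j i => x j * M i j).
  assert (Hv : forall j, ell2 (v j)) by (intro j; apply ell2_scal, Hc).
  assert (Hn : ex_series (fun j => nrm (v j))).
  { apply (ex_series_dominated _ (fun j => nrm u * (u j * Rabs (x j)))).
    - intro j. rewrite Rabs_pos_eq by apply nrm_ge_0.
      unfold v. rewrite nrm_scal.
      replace (nrm u * (u j * Rabs (x j))) with (Rabs (x j) * (u j * nrm u)) by ring.
      apply Rmult_le_compat_l; [apply Rabs_pos|].
      destruct HM as (H0 & _ & H).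
      rewrite <- (Rabs_pos_eq (u j)), <- nrm_scal by apply H0.
      apply sqrt_le_1_alt. rewrite !dot_sq. apply Series_le.
      + intro i. split; [apply pow2_ge_0|].
        rewrite <- pow2_abs. apply pow_incr.
        split; [apply Rabs_pos|]. rewrite Rmult_comm. apply H.
      + apply (ell2_scal (u j) u ell2_weight).
    - apply (ex_series_mult_l (nrm u)), ex_weight_abs, Hx. }
  pose proof (is_series_unique _ _ (vseries_dot v y Hv Hn Hy)) as H.
  transitivity (dot (fun i => Series (fun j => v j i)) y).
  - apply Series_ext. intro i. f_equal. apply Series_ext. intro j. apply Rmult_comm.
  - rewrite <- H. apply Series_ext. intro j. unfold v. rewrite dot_scal_l. reflexivity.
Qed.

(** This is the compactness of the operator, in the form in which the spectral argument uses it. *)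
Lemma nrm_mv_lim (z : nat -> nat -> R) (y : nat -> R) (C : R) :
  (forall m, ell2 (z m)) -> ell2 y -> (forall m j, Rabs (z m j - y j) <= C) ->
  (forall j, is_lim_seq (fun m => z m j) (y j)) ->
  is_lim_seq (fun m => nrm (lin 1 (A (z m)) (-1) (A y))) 0.
Proof.
  intros Hz Hy HC Hl.
  apply is_lim_seq_le_le with (fun _ => 0)
    (fun m => nrm u * Series (fun j => u j * Rabs (z m j - y j))).
  - intro m. split; [apply nrm_ge_0|].
    rewrite <- mv_lin by auto.
    apply Rle_trans with (1 := nrm_mv_le _ (ell2_lin _ _ _ _ (Hz m) Hy)).
    right. f_equal. apply Series_ext. intro j. unfold lin. do 2 f_equal. ring.
  - apply is_lim_seq_const.
  - rewrite <- (Rmult_0_r (nrm u)).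
    apply is_lim_seq_mult'; [apply is_lim_seq_const|].
    destruct HM as (H0 & Hs & _).
    apply (Series_dominated_lim u (fun m j => z m j - y j) C H0 Hs HC).
    intro j. rewrite <- (Rminus_diag (y j)).
    apply is_lim_seq_minus'; [apply Hl | apply is_lim_seq_const].
Qed.

End Dominated.

(** * Eigenvectors of the Gram operator *)

Definition gram (M : nat -> nat -> R) (x : nat -> R) : nat -> R := mv (tr M) (mv M x).

(** For a unit eigenvector [<B e, e> = <A e, A e>] determines the eigenvalue, so it is written out
    instead of being carried as a parameter. *)
Definition unit_eigenvector (M : nat -> nat -> R) (e : nat -> R) : Prop :=
  ell2 e /\ dot e e = 1 /\ gram M e = fun i => dot (mv M e) (mv M e) * e i.

Definition perp (W : (nat -> R) -> Prop) (x : nat -> R) : Prop :=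
  ell2 x /\ forall w, W w -> dot x w = 0.

Lemma normalise (x : nat -> R) :
  0 < dot x x -> exists c, dot (fun i => c * x i) (fun i => c * x i) = 1.
Proof.
  intro H. exists (/ sqrt (dot x x)). rewrite dot_scal_l, dot_scal_r.
  pose proof (sqrt_lt_R0 _ H). rewrite <- (sqrt_sqrt (dot x x)) at 3 by lra.
  field. lra.
Qed.

Section Spectral.
Context (M : nat -> nat -> R) (u : nat -> R).
Context (HM : dominated M u).

Let A := mv M.
Let q (x : nat -> R) := dot (A x) (A x).

Lemma ell2_gram (x : nat -> R) : ell2 x -> ell2 (gram M x).
Proof.
  intro Hx. apply (ell2_mv _ u); [apply dominated_tr, HM|]. apply (ell2_mv _ u HM), Hx.
Qed.

Lemma gram_scal (c : R) (x : nat -> R) :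
  gram M (fun i => c * x i) = fun i => c * gram M x i.
Proof. unfold gram. rewrite mv_scal. apply mv_scal. Qed.

Lemma dot_gram (x y : nat -> R) :
  ell2 x -> ell2 y -> dot (gram M x) y = dot (mv M x) (mv M y).
Proof.
  intros Hx Hy. unfold gram.
  apply (dot_mv (tr M) u (dominated_tr M u HM)); [|exact Hy].
  apply (ell2_mv _ u HM), Hx.
Qed.

Lemma gram_sym (x y : nat -> R) :
  ell2 x -> ell2 y -> dot (gram M x) y = dot x (gram M y).
Proof.
  intros Hx Hy. rewrite dot_gram by assumption. rewrite (dot_comm x), dot_gram by assumption.
  apply dot_comm.
Qed.

Lemma unit_eigenvector_of (y : nat -> R) (l : R) :
  ell2 y -> 0 < dot y y -> gram M y = (fun i => l * y i) ->
  exists c, unit_eigenvector M (fun i => c * y i).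
Proof.
  intros Hy H0 Hl. destruct (normalise y H0) as [c Hc]. exists c.
  split; [apply ell2_scal, Hy|]. split; [exact Hc|].
  assert (Hq : dot (mv M (fun i => c * y i)) (mv M (fun i => c * y i)) = l).
  { rewrite <- dot_gram by (apply ell2_scal, Hy).
    rewrite gram_scal, Hl.
    replace (fun i => c * (l * y i)) with (fun i => l * (c * y i))
      by (apply functional_extensionality; intro; ring).
    rewrite (dot_scal_l l (fun i => c * y i)), Hc. ring. }
  rewrite Hq, gram_scal, Hl. apply functional_extensionality. intro i. ring.
Qed.

Lemma quad_bounded (x : nat -> R) : ell2 x -> q x <= (nrm u * Series u) ^ 2 * dot x x.
Proof.
  intro Hx. unfold q. rewrite <- !nrm_sq by (try apply (ell2_mv _ u HM); exact Hx).
  rewrite <- Rpow_mult_distr. apply pow_incr. split; [apply nrm_ge_0|].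
  apply (nrm_mv_bounded _ _ HM), Hx.
Qed.

Lemma quad_le_on_perp (W : (nat -> R) -> Prop) (l : R) :
  (forall x, perp W x -> dot x x = 1 -> q x <= l) ->
  forall x, perp W x -> q x <= l * dot x x.
Proof.
  intros Hl x [Hx Hp]. destruct (Rle_or_lt (dot x x) 0) as [H0|H0].
  - pose proof (quad_bounded x Hx). pose proof (dot_ge_0 x Hx).
    replace (dot x x) with 0 in * by lra. lra.
  - destruct (normalise x H0) as [c Hc].
    assert (Hq : q (fun i => c * x i) <= l).
    { apply Hl; [|exact Hc]. split; [apply ell2_scal, Hx|].
      intros w Hw. rewrite dot_scal_l, (Hp w Hw). ring. }
    unfold q, A in *. rewrite mv_scal, dot_scal_l, dot_scal_r in Hq.
    rewrite dot_scal_l, dot_scal_r in Hc.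
    apply Rmult_le_reg_l with (c * c).
    + apply Rsqr_pos_lt. intros ->. lra.
    + replace (c * c * (l * dot x x)) with (l * (c * (c * dot x x))) by ring.
      rewrite Hc. lra.
Qed.

(* On [perp W] the form [q] has supremum [l].  Cauchy-Schwarz gives
   [|B z|^2 <= l q(z)], whence [|B z - l z|^2 <= l (l - q(z))] for unit [z]: a maximizing
   sequence consists of approximate eigenvectors. *)
Lemma approximate_eigenvector (W : (nat -> R) -> Prop) (l : R) (z : nat -> R) :
  0 <= l ->
  (forall x, perp W x -> dot x x = 1 -> q x <= l) ->
  (forall x, perp W x -> perp W (gram M x)) ->
  perp W z -> dot z z = 1 ->
  nrm (lin 1 (gram M z) (- l) z) ^ 2 <= l * (l - q z).
Proof.
  intros Hl0 Hl HW Hz H1.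
  assert (Hez := proj1 Hz).
  assert (HB := ell2_gram z Hez).
  rewrite nrm_sq by (apply ell2_lin; assumption).
  rewrite dot_lin_l, !dot_lin_r by (try apply ell2_lin; assumption).
  rewrite (dot_comm z (gram M z)), (dot_gram z z), H1 by assumption. fold A (q z).
  enough (dot (gram M z) (gram M z) <= l * q z) by lra.
  (* Here [|B z|^2 = <A z, A (B z)>]. As [B z] lies in [perp W] again, [q (B z) <= l |B z|^2], and
     one factor [|B z|^2] cancels at the end. *)
  assert (Hcs : dot (gram M z) (gram M z) ^ 2 <= q z * q (gram M z)).
  { rewrite (dot_gram z (gram M z)) by assumption.
    apply cauchy_schwarz; apply (ell2_mv _ u HM); assumption. }
  pose proof (quad_le_on_perp W l Hl (gram M z) (HW z Hz)) as HqB.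
  assert (0 <= q z) by (apply dot_ge_0, (ell2_mv _ u HM), Hez).
  pose proof (dot_ge_0 _ HB) as HB0.
  destruct (Rle_or_lt (dot (gram M z) (gram M z)) 0) as [H0|H0]; [nra|].
  apply Rmult_le_reg_l with (dot (gram M z) (gram M z)); [exact H0|]. nra.
Qed.

(** Rayleigh's principle on an invariant subspace. A coordinatewise limit [y] of a maximizing
    sequence satisfies [B y = l y]. It need not be a unit vector, only nonzero, and [l > 0]
    guarantees that; for [l = 0] every unit vector of the subspace is already an eigenvector. *)
Lemma eigenvector_in_perp (W : (nat -> R) -> Prop) (x0 : nat -> R) :
  (forall w, W w -> ell2 w) ->
  (forall x, perp W x -> perp W (gram M x)) ->
  perp W x0 -> 0 < dot x0 x0 ->
  exists e, unit_eigenvector M e /\ perp W e.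
Proof.
  intros HWe HW [Hx0 Hp0] H0.
  assert (Hscal : forall c x, perp W x -> perp W (fun i => c * x i)).
  { intros c x [Hx Hp]. split; [apply ell2_scal, Hx|].
    intros w Hw. rewrite dot_scal_l, Hp by exact Hw. ring. }
  destruct (normalise x0 H0) as [c0 Hc0].
  set (x1 := fun i => c0 * x0 i) in *.
  assert (Hx1 : perp W x1) by (apply Hscal; split; assumption).
  destruct (completeness (fun t => exists x, perp W x /\ dot x x = 1 /\ t = q x))
    as [l [Hub Hlub]].
  { exists ((nrm u * Series u) ^ 2). intros t (x & [Hx _] & Hxx & ->).
    rewrite <- (Rmult_1_r (_ ^ 2)), <- Hxx. apply quad_bounded, Hx. }
  { exists (q x1), x1. auto. }
  assert (Hl : forall x, perp W x -> dot x x = 1 -> q x <= l).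
  { intros x Hx Hxx. apply Hub. exists x. auto. }
  assert (Hl0 : 0 <= l).
  { apply Rle_trans with (q x1); [|apply Hl; assumption].
    apply dot_ge_0, (ell2_mv _ u HM), Hx1. }
  destruct Hl0 as [Hl0|Hl0].
  - destruct (choice (fun k z => perp W z /\ dot z z = 1 /\ l - / (INR k + 1) < q z))
      as [z Hz].
    { intro k. apply NNPP. intro Hno.
      assert (l <= l - / (INR k + 1)).
      { apply Hlub. intros t (x & Hx & Hxx & ->).
        apply Rnot_lt_le. intro Hlt. apply Hno. exists x. auto. }
      pose proof (Rinv_0_lt_compat _ (INRp1_pos k)). lra. }
    destruct (pointwise_subsequence z) as (phi & y & Hphi & Hlim).
    { intros k i. destruct (Hz k) as ([Hk _] & Hkk & _).
      apply Rle_trans with (1 := coord_le_nrm _ i Hk). unfold nrm. rewrite Hkk, sqrt_1. lra. }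
    pose (s := fun m => z (phi m)).
    assert (Hs : forall m, perp W (s m)) by (intro; apply Hz).
    assert (Hss : forall m, dot (s m) (s m) = 1) by (intro; apply Hz).
    assert (Hse : forall m, ell2 (s m)) by (intro; apply Hs).
    assert (Hs1 : forall m i, Rabs (s m i) <= 1).
    { intros m i. apply Rle_trans with (1 := coord_le_nrm _ i (Hse m)).
      unfold nrm. rewrite Hss, sqrt_1. lra. }
    assert (Hqs : is_lim_seq (fun m => q (s m)) l).
    { apply is_lim_seq_le_le with (fun m => l - / (INR m + 1)) (fun _ => l).
      - intro m. split; [|apply Hl; auto].
        destruct (Hz (phi m)) as (_ & _ & H). apply Rlt_le in H.
        apply Rle_trans with (2 := H). apply Rplus_le_compat_l, Ropp_le_contravar.
        apply Rinv_le_contravar; [apply INRp1_pos|].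
        apply Rplus_le_compat_r, le_INR, Hphi.
      - replace (Finite l) with (Finite (l - 0)) by (f_equal; ring).
        apply is_lim_seq_minus'; [apply is_lim_seq_const|].
        apply (is_lim_seq_ext (fun m => / INR (S m))).
        + intro m. rewrite S_INR. reflexivity.
        + apply (is_lim_seq_incr_1 (fun m => / INR m)).
          apply (is_lim_seq_inv INR p_infty); [apply is_lim_seq_INR | discriminate].
      - apply is_lim_seq_const. }
    assert (Hy : ell2 y).
    { apply (ex_series_bounded _ 1); [intro; apply pow2_ge_0|]. intro N.
      apply is_lim_seq_le_const with (fun m => psum (fun i => s m i ^ 2) N).
      - intro m. rewrite <- (Hss m), dot_sq.
        apply psum_le_Series; [intro; apply pow2_ge_0 | apply Hse].
      - apply (is_lim_seq_psum (fun m i => s m i ^ 2)). intro i. simpl.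
        apply (is_lim_seq_mult' _ _ _ _ (Hlim i)).
        apply (is_lim_seq_mult' _ _ _ _ (Hlim i) (is_lim_seq_const 1)). }
    assert (HAs : forall m, ell2 (A (s m))) by (intro; apply (ell2_mv _ u HM), Hse).
    assert (HAy : ell2 (A y)) by (apply (ell2_mv _ u HM), Hy).
    assert (HA : is_lim_seq (fun m => nrm (lin 1 (A (s m)) (-1) (A y))) 0).
    (* The coordinates of the unit vectors [s m] and of their limit lie in [[-1, 1]], hence differ
       by at most [2]. *)
    { apply (nrm_mv_lim M u HM s y 2); auto.
      intros m j. apply Rabs_le_between.
      pose proof (proj1 (Rabs_le_between _ _) (Hs1 m j)).
      assert (-1 <= y j <= 1); [|lra].
      split.
      - enough (- y j <= 1) by lra.
        apply is_lim_seq_le_const with (fun m => - s m j).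
        + intro n. pose proof (proj1 (Rabs_le_between _ _) (Hs1 n j)). lra.
        + apply (is_lim_seq_opp _ (y j)), Hlim.
      - apply is_lim_seq_le_const with (fun m => s m j); [|apply Hlim].
        intro n. pose proof (proj1 (Rabs_le_between _ _) (Hs1 n j)). lra. }
    (* [B (s m)] converges weakly to [B y] and is asymptotic to [l (s m)]. *)
    assert (Hweak : forall d, ell2 d ->
      is_lim_seq (fun m => l * dot (s m) d) (dot (gram M y) d)).
    { intros d Hd.
      apply is_lim_seq_ext with
        (fun m => dot (A (s m)) (A d) - dot (lin 1 (gram M (s m)) (- l) (s m)) d).
      { intro m. rewrite dot_lin_l, dot_gram by auto using ell2_gram. unfold A. ring. }
      rewrite dot_gram by assumption.
      replace (Finite (dot (mv M y) (mv M d)))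
        with (Finite (dot (A y) (A d) - 0)) by (unfold A; f_equal; ring).
      apply is_lim_seq_minus'.
      - apply nrm_lim_dot; auto. apply (ell2_mv _ u HM), Hd.
      - apply is_lim_seq_abs_0.
        apply is_lim_seq_le_le with (fun _ => 0)
          (fun m => sqrt (l * (l - q (s m))) * nrm d).
        + intro m. split; [apply Rabs_pos|].
          eapply Rle_trans;
            [apply dot_abs_le; [apply ell2_lin; auto using ell2_gram | exact Hd]|].
          apply Rmult_le_compat_r; [apply nrm_ge_0|].
          rewrite <- (sqrt_pow2 (nrm _) (nrm_ge_0 _)). apply sqrt_le_1_alt.
          apply (approximate_eigenvector W); auto. lra.
        + apply is_lim_seq_const.
        + rewrite <- (Rmult_0_l (nrm d)).
          apply is_lim_seq_mult'; [|apply is_lim_seq_const].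
          rewrite <- sqrt_0.
          apply (is_lim_seq_continuous sqrt); [apply continuity_pt_sqrt; lra|].
          replace 0 with (l * (l - l)) by ring.
          apply is_lim_seq_mult'; [apply is_lim_seq_const|].
          apply is_lim_seq_minus'; [apply is_lim_seq_const | exact Hqs]. }
    assert (HBy : gram M y = fun i => l * y i).
    { apply functional_extensionality. intro i.
      pose proof (Hweak (delta i) (ell2_delta i)) as H.
      apply (is_lim_seq_ext _ (fun m => l * s m i)) in H.
      2: { intro m. rewrite dot_delta. reflexivity. }
      rewrite dot_delta in H.
      pose proof (is_lim_seq_mult' _ _ _ _ (is_lim_seq_const l) (Hlim i)) as H'.
      apply is_lim_seq_unique in H. apply is_lim_seq_unique in H'.
      unfold s in H. rewrite H' in H. injection H as H. symmetry. exact H. }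
    (* By [Hweak], [l <y, w> = <B y, w>] is a limit of zeros; [l > 0] allows division. *)
    assert (Hpy : forall w, W w -> dot y w = 0).
    { intros w Hw. pose proof (Hweak w (HWe w Hw)) as H.
      apply (is_lim_seq_ext _ (fun _ => 0)) in H.
      2: { intro m. rewrite (proj2 (Hs m) w Hw). ring. }
      apply is_lim_seq_unique in H. rewrite Lim_seq_const in H. injection H as H.
      rewrite HBy, dot_scal_l in H. apply Rmult_eq_reg_l with l; lra. }
    (* If [y] were zero, then [A y = 0] and [HA] would force [q (s m)] to tend to [0], whereas it
       tends to [l > 0]. *)
    assert (Hyy : 0 < dot y y).
    { assert (HqyL : is_lim_seq (fun m => q (s m)) 0 -> False).
      { intro H. apply is_lim_seq_unique in H. apply is_lim_seq_unique in Hqs.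
        rewrite H in Hqs. injection Hqs as Hqs. lra. }
      destruct (Rle_or_lt (dot y y) 0) as [Hy0|Hy0]; [|exact Hy0]. exfalso. apply HqyL.
      assert (Hy1 : forall i, A y i = 0).
      { intro i. unfold A, mv. rewrite (Series_ext _ (fun j => 0 * M i j)).
        - rewrite Series_scal_l. ring.
        - intro j. rewrite (dot_eq_0 y Hy Hy0 j). ring. }
      apply is_lim_seq_ext with
        (fun m => nrm (lin 1 (A (s m)) (-1) (A y)) * nrm (lin 1 (A (s m)) (-1) (A y))).
      { intro m. replace (lin 1 (A (s m)) (-1) (A y)) with (A (s m)).
        - unfold q. rewrite <- nrm_sq by auto. ring.
        - apply functional_extensionality. intro i. unfold lin. rewrite Hy1. ring. }
      rewrite <- (Rmult_0_l 0). apply is_lim_seq_mult'; exact HA. }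
    destruct (unit_eigenvector_of y l Hy Hyy HBy) as [c Hc].
    exists (fun i => c * y i). split; [exact Hc|]. apply Hscal. split; assumption.
  (* Case [l = 0]: [q] vanishes on unit vectors of [perp W], so [A x1 = 0] and [x1] has eigenvalue
     [0]. *)
  - exists x1. split; [|exact Hx1].
    assert (HA0 : forall i, A x1 i = 0).
    { apply dot_eq_0; [apply (ell2_mv _ u HM), Hx1|].
      rewrite Hl0. apply Hl; assumption. }
    split; [apply Hx1|]. split; [exact Hc0|].
    apply functional_extensionality. intro i.
    replace (gram M x1 i) with 0.
    + unfold dot. rewrite (Series_ext _ (fun j => 0 * A x1 j)).
      * rewrite Series_scal_l. ring.
      * intro j. unfold A in HA0. rewrite HA0. ring.
    + unfold gram, mv at 1. rewrite (Series_ext _ (fun j => 0 * tr M i j)).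
      * rewrite Series_scal_l. ring.
      * intro j. unfold A in HA0. rewrite HA0. ring.
Qed.

End Spectral.

(** * Orthonormal eigenbases, kernel included *)

Lemma perp_gram (M : nat -> nat -> R) (u : nat -> R) (W : (nat -> R) -> Prop) :
  dominated M u -> (forall w, W w -> unit_eigenvector M w) ->
  forall x, perp W x -> perp W (gram M x).
Proof.
  intros HM HW x [Hx Hp]. split; [apply (ell2_gram M u HM), Hx|].
  intros w Hw. destruct (HW w Hw) as (Hew & _ & Heig).
  rewrite (gram_sym M u HM) by assumption. rewrite Heig, dot_scal_r, (Hp w Hw). ring.
Qed.

(** The coefficients are summable, so [bessel_weighted] bounds the total over orthonormal systems,
    and strictly positive, so no nonzero vector has weight [0]. The sequence [u] cannot take this
    role, as some [u j] may be zero. *)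
Definition geom_weight (x : nat -> R) : R := Series (fun j => (/ 2) ^ j * x j ^ 2).

Lemma geom_ge_0 (j : nat) : 0 <= (/ 2) ^ j.
Proof. apply pow_le. lra. Qed.

Lemma ex_geom : ex_series (fun j => (/ 2) ^ j).
Proof. apply ex_series_geom. rewrite Rabs_pos_eq; lra. Qed.

Lemma geom_weight_pos (x : nat -> R) : ell2 x -> 0 < dot x x -> 0 < geom_weight x.
Proof.
  intros Hx H0.
  destruct (classic (exists j, x j <> 0)) as [[j Hj]|Hno].
  - apply Rlt_le_trans with ((/ 2) ^ j * x j ^ 2).
    + apply Rmult_lt_0_compat; [apply pow_lt; lra|]. apply pow2_gt_0, Hj.
    + apply (term_le_Series (fun j => (/ 2) ^ j * x j ^ 2)).
      * intro n. apply Rmult_le_pos; [apply geom_ge_0 | apply pow2_ge_0].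
      * apply ex_weighted; [exact geom_ge_0 | exact ex_geom | exact Hx].
  - exfalso. assert (Hz : x = fun _ => 0).
    { apply functional_extensionality. intro j. apply NNPP. intro Hj. apply Hno. exists j. exact Hj. }
    rewrite Hz, dot_0_l in H0. lra.
Qed.

Section Eigenbasis.
Context (M : nat -> nat -> R) (u : nat -> R).
Context (HM : dominated M u).

Lemma orthosys_eigenvectors (f : nat -> nat -> R) (N : nat) :
  (forall n, (n < N)%nat -> unit_eigenvector M (f n)) ->
  (forall n k, (n < N)%nat -> (k < n)%nat -> dot (f n) (f k) = 0) ->
  orthosys f N.
Proof.
  intros He Ho. split; [|split].
  - intros n Hn. apply He, Hn.
  - intros m n Hm Hn Hne. destruct (Nat.lt_ge_cases n m) as [H|H].
    + apply Ho; assumption.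
    + rewrite dot_comm. apply Ho; [assumption | lia].
  - intros n Hn. left. apply He, Hn.
Qed.

(* Each eigenvector is chosen so as to maximize [geom_weight] up to a factor [2] among
   the candidates.  Since the total weight of an orthonormal sequence is at most [2], the
   weights of the choices tend to [0], so no eigenvector, in the kernel or not, is orthogonal
   to all of them. *)
Lemma eigenbasis :
  exists e : nat -> nat -> R,
    (forall n, unit_eigenvector M (e n)) /\
    (forall m n, m <> n -> dot (e m) (e n) = 0) /\
    (forall x, ell2 x -> (forall n, dot x (e n) = 0) -> forall i, x i = 0).
Proof.
  assert (Hbd : forall v, unit_eigenvector M v -> geom_weight v <= Series (fun j => (/ 2) ^ j)).
  { intros v Hv.
    pose proof (bessel_weighted _ (fun _ => v) 1 geom_ge_0 ex_geom) as H.
    simpl in H. rewrite Rplus_0_l in H. apply H.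
    apply (orthosys_eigenvectors (fun _ => v)); [auto | intros; lia]. }
  destruct (prefix_choice (nat -> R) (fun _ => 0) (fun n f x =>
    unit_eigenvector M x /\ (forall k, (k < n)%nat -> dot x (f k) = 0) /\
    forall v, unit_eigenvector M v -> (forall k, (k < n)%nat -> dot v (f k) = 0) ->
      geom_weight v <= 2 * geom_weight x)) as [e He].
  - intros n f g x Hfg (H1 & H2 & H3). split; [exact H1|]. split.
    + intros k Hk. rewrite <- Hfg by exact Hk. apply H2, Hk.
    + intros v Hv Hvg. apply H3; [exact Hv|]. intros k Hk. rewrite Hfg by exact Hk. auto.
  - intros n f IH.
    assert (Hsys : orthosys f n).
    { apply orthosys_eigenvectors.
      - intros k Hk. apply (IH k Hk).
      - intros k j Hk Hj. apply (IH k Hk), Hj. }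
    (* Infinite dimension keeps the selection from stopping: a nonzero vector is always left outside
       the span of finitely many eigenvectors. *)
    destruct (orthosys_complement f n Hsys) as (r & Hr & Hrf & Hr0).
    pose (W := fun w => exists k, (k < n)%nat /\ w = f k).
    destruct (eigenvector_in_perp M u HM W r) as (v & Hv & Hev & Hvp).
    + intros w (k & Hk & ->). apply (IH k Hk).
    + apply (perp_gram M u W HM). intros w (k & Hk & ->). apply (IH k Hk).
    + split; [exact Hr|]. intros w (k & Hk & ->). apply Hrf, Hk.
    + exact Hr0.
    + assert (Hvf : forall k, (k < n)%nat -> dot v (f k) = 0).
      { intros k Hk. apply Hvp. exists k. auto. }
      (* The supremum [l] of the candidate weights need not be attained, hence the factor [2]: if no
         candidate had weight above [l / 2], that number would be a smaller upper bound. *)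
      destruct (completeness (fun t => exists x, unit_eigenvector M x /\
        (forall k, (k < n)%nat -> dot x (f k) = 0) /\ t = geom_weight x)) as [l [Hub Hlub]].
      { exists (Series (fun j => (/ 2) ^ j)). intros t (x & Hx & _ & ->). apply Hbd, Hx. }
      { exists (geom_weight v), v. auto. }
      assert (Hl0 : 0 < l).
      { apply Rlt_le_trans with (geom_weight v).
        - apply geom_weight_pos; [exact Hev|]. destruct Hv as (_ & -> & _). lra.
        - apply Hub. exists v. auto. }
      apply NNPP. intro Hno.
      assert (l <= l / 2); [|lra].
      apply Hlub. intros t (x & Hx & Hxf & ->).
      apply Rnot_lt_le. intro Hlt. apply Hno. exists x. split; [exact Hx|]. split; [exact Hxf|].
      intros y Hy Hyf.
      assert (geom_weight y <= l); [|lra]. apply Hub. exists y. auto.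
  - exists e. split; [intro; apply He|]. split.
    + intros m n Hne. destruct (Nat.lt_ge_cases n m) as [H|H].
      * apply (He m), H.
      * rewrite dot_comm. apply (He n). lia.
    + intros x Hx Hxe i. apply NNPP. intro Hi.
      pose (W := fun w => exists n, w = e n).
      destruct (eigenvector_in_perp M u HM W x) as (v & Hv & Hev & Hvp).
      * intros w (n & ->). apply (He n).
      * apply (perp_gram M u W HM). intros w (n & ->). apply (He n).
      * split; [exact Hx|]. intros w (n & ->). apply Hxe.
      * apply dot_nonzero with i; assumption.
      * assert (Hve : forall n, dot v (e n) = 0) by (intro n; apply Hvp; exists n; auto).
        assert (Hv0 : 0 < geom_weight v).
        { apply geom_weight_pos; [exact Hev|]. destruct Hv as (_ & -> & _). lra. }
        (* [v] was a candidate at every stage, so each [e n] has at least half its weight, while the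
           total weight stays bounded. *)
        assert (HN : forall N, INR N * (geom_weight v / 2) <= Series (fun j => (/ 2) ^ j)).
        { intro N. rewrite <- psum_const.
          apply Rle_trans with (psum (fun n => geom_weight (e n)) N).
          - apply psum_le. intros n _.
            destruct (He n) as (_ & _ & H). specialize (H v Hv (fun k _ => Hve k)). lra.
          - apply (bessel_weighted _ e N geom_ge_0 ex_geom). apply orthosys_eigenvectors.
            + intros n _. apply (He n).
            + intros n k _ Hk. apply (He n), Hk. }
        destruct (INR_unbounded (Series (fun j => (/ 2) ^ j) / (geom_weight v / 2))) as [N H].
        specialize (HN N).
        apply Rgt_lt, (Rmult_lt_compat_r (geom_weight v / 2)) in H; [|lra].
        replace (Series (fun j => (/ 2) ^ j) / (geom_weight v / 2) * (geom_weight v / 2))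
          with (Series (fun j => (/ 2) ^ j)) in H by (field; lra).
        lra.
Qed.

(** * Summability of the singular values *)

(** Ordinary Cauchy-Schwarz for [sqrt (u j)] and [sqrt (u j) * Rabs (x j)]. *)
Lemma weighted_cauchy_schwarz (x : nat -> R) :
  ell2 x ->
  Series (fun j => u j * Rabs (x j)) ^ 2 <= Series u * Series (fun j => u j * x j ^ 2).
Proof.
  intro Hx. destruct HM as (H0 & Hs & _).
  pose (a := fun j => sqrt (u j)). pose (b := fun j => sqrt (u j) * Rabs (x j)).
  assert (Ea : forall j, a j * a j = u j) by (intro; apply sqrt_sqrt, H0).
  assert (Ha : ell2 a).
  { apply (ex_series_ext u); [|exact Hs]. intro j. unfold a.
    rewrite pow2_sqrt by apply H0. reflexivity. }
  assert (Hb : ell2 b).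
  { apply (ex_series_ext (fun j => u j * x j ^ 2)).
    - intro j. unfold b. rewrite Rpow_mult_distr, pow2_abs, pow2_sqrt by apply H0. reflexivity.
    - apply ex_weighted; assumption. }
  replace (Series (fun j => u j * Rabs (x j))) with (dot a b).
  2: { apply Series_ext. intro j. unfold a, b.
       rewrite <- Rmult_assoc, sqrt_sqrt by apply H0. reflexivity. }
  replace (Series u) with (dot a a) by (apply Series_ext; exact Ea).
  replace (Series (fun j => u j * x j ^ 2)) with (dot b b).
  2: { rewrite dot_sq. apply Series_ext. intro j. unfold b.
       rewrite Rpow_mult_distr, pow2_abs, pow2_sqrt by apply H0. reflexivity. }
  apply cauchy_schwarz; assumption.
Qed.

(** The product of the two weighted sums is replaced by half the sum of their squares, so that [x]
    and [y] separate and [bessel_weighted] can be applied to each family. *)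
Lemma bilinear_le (x y : nat -> R) :
  ell2 x -> ell2 y ->
  dot (mv M x) y <=
    Series u * / 2 * Series (fun j => u j * x j ^ 2)
    + Series u * / 2 * Series (fun j => u j * y j ^ 2).
Proof.
  intros Hx Hy.
  set (a := Series (fun j => u j * Rabs (x j))).
  set (b := Series (fun j => u j * Rabs (y j))).
  assert (H : dot (mv M x) y <= a * b).
  { apply Rle_trans with (1 := Rle_abs _). unfold b. rewrite <- Series_scal_l.
    apply Series_abs_le.
    - intro i. rewrite Rabs_mult, <- Rmult_assoc. apply Rmult_le_compat_r; [apply Rabs_pos|].
      rewrite Rmult_comm. apply (mv_coord_le M u HM x i Hx).
    - apply ex_series_mult_l, (ex_weight_abs M u HM), Hy. }
  pose proof (weighted_cauchy_schwarz x Hx) as Ha. fold a in Ha.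
  pose proof (weighted_cauchy_schwarz y Hy) as Hb. fold b in Hb.
  pose proof (pow2_ge_0 (a - b)). nra.
Qed.

(* With [f n = A e_n / |A e_n|] one has [|A e_n| = <A e_n, f n>], and both [e] and [f]
   are orthogonal systems. *)
Lemma ex_series_singular_values (e : nat -> nat -> R) :
  (forall n, unit_eigenvector M (e n)) ->
  (forall m n, m <> n -> dot (e m) (e n) = 0) ->
  ex_series (fun n => nrm (mv M (e n))).
Proof.
  intros He Ho.
  assert (Hee : forall n, ell2 (e n)) by (intro; apply He).
  assert (HA : forall n, ell2 (mv M (e n))) by (intro; apply (ell2_mv M u HM), Hee).
  pose (s := fun n => nrm (mv M (e n))).
  assert (Hs : forall n, dot (mv M (e n)) (mv M (e n)) = s n * s n).
  { intro n. rewrite <- nrm_sq by apply HA. unfold s. ring. }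
  (* When [s n = 0] the vector [A e_n] is zero, so [f n] is zero whatever [/ 0] denotes. *)
  pose (f := fun n i => / s n * mv M (e n) i).
  assert (Hes : forall N, orthosys e N).
  { intro N. apply orthosys_eigenvectors; [auto|]. intros n k _ Hk. apply Ho. lia. }
  assert (Hfs : forall N, orthosys f N).
  { intro N. split; [|split].
    - intros n _. apply ell2_scal, HA.
    (* The images stay orthogonal because [<A e_m, A e_n> = <B e_m, e_n>] is a multiple of
       [<e_m, e_n>]. *)
    - intros m n _ _ Hne. unfold f. rewrite dot_scal_l, dot_scal_r.
      rewrite <- (dot_gram M u HM) by auto. destruct (He m) as (_ & _ & ->).
      rewrite dot_scal_l, Ho by exact Hne. ring.
    - intros n _. unfold f. rewrite dot_scal_l, dot_scal_r, Hs.
      destruct (Req_dec (s n) 0) as [E|E].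
      + right. rewrite E. ring.
      + left. field. exact E. }
  destruct HM as (H0 & Hsu & _).
  apply (ex_series_bounded _ (Series u * Series u)).
  { intro n. apply nrm_ge_0. }
  intro N.
  apply Rle_trans with (psum (fun n =>
    Series u * / 2 * Series (fun j => u j * e n j ^ 2)
    + Series u * / 2 * Series (fun j => u j * f n j ^ 2)) N).
  - apply psum_le. intros n _.
    apply Rle_trans with (dot (mv M (e n)) (f n)).
    + unfold f. rewrite dot_scal_r, Hs. fold (s n). right.
      destruct (Req_dec (s n) 0) as [E|E]; [rewrite E; ring | field; exact E].
    + apply bilinear_le; [apply Hee|]. apply ell2_scal, HA.
  - rewrite psum_lin.
    pose proof (bessel_weighted u e N H0 Hsu (Hes N)).
    pose proof (bessel_weighted u f N H0 Hsu (Hfs N)).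
    pose proof (Series_nonneg u H0 Hsu). nra.
Qed.

End Eigenbasis.

(** * Diagonal operators *)

(** For summable [s] and unit vectors [e n] the series converges absolutely in norm, so the lemmas
    on absolutely convergent series of vectors replace Parseval's identity. *)
Definition diag_op (s : nat -> R) (e : nat -> nat -> R) (x : nat -> R) : nat -> R :=
  fun i => Series (fun n => s n * dot x (e n) * e n i).

Section Diagonal.
Context (s : nat -> R) (e : nat -> nat -> R).
Context (Hs0 : forall n, 0 <= s n).
Context (Hs : ex_series s).
Context (He : forall n, ell2 (e n)).
Context (He1 : forall n, dot (e n) (e n) = 1).
Context (Ho : forall m n, m <> n -> dot (e m) (e n) = 0).

Let v (x : nat -> R) (n : nat) : nat -> R := fun i => s n * dot x (e n) * e n i.

Lemma ell2_diag_term (x : nat -> R) (n : nat) : ell2 (v x n).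
Proof. apply ell2_scal, He. Qed.

Lemma nrm_diag_term (x : nat -> R) (n : nat) : ell2 x -> nrm (v x n) <= nrm x * s n.
Proof.
  intro Hx. unfold v. rewrite nrm_scal, Rabs_mult, (Rabs_pos_eq (s n)) by apply Hs0.
  assert (Hn : nrm (e n) = 1) by (unfold nrm; rewrite He1; apply sqrt_1).
  pose proof (dot_abs_le x (e n) Hx (He n)) as H. rewrite Hn in *. specialize (Hs0 n). nra.
Qed.

Lemma ex_diag_nrm (x : nat -> R) : ell2 x -> ex_series (fun n => nrm (v x n)).
Proof.
  intro Hx. apply (ex_series_dominated _ (fun n => nrm x * s n)).
  - intro n. rewrite Rabs_pos_eq by apply nrm_ge_0. apply nrm_diag_term, Hx.
  - apply ex_series_mult_l, Hs.
Qed.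

Lemma ell2_diag (x : nat -> R) : ell2 x -> ell2 (diag_op s e x).
Proof.
  intro Hx. apply (vseries_bound (v x) (ell2_diag_term x) (ex_diag_nrm x Hx)).
Qed.

Lemma nrm_diag_le (x : nat -> R) : ell2 x -> nrm (diag_op s e x) <= Series s * nrm x.
Proof.
  intro Hx.
  apply Rle_trans with (1 := proj2 (vseries_bound (v x) (ell2_diag_term x) (ex_diag_nrm x Hx))).
  rewrite Rmult_comm, <- Series_scal_l. apply Series_le.
  - intro n. split; [apply nrm_ge_0 | apply nrm_diag_term, Hx].
  - apply ex_series_mult_l, Hs.
Qed.

Lemma dot_diag (x y : nat -> R) :
  ell2 x -> ell2 y ->
  is_series (fun n => s n * dot x (e n) * dot y (e n)) (dot (diag_op s e x) y).
Proof.
  intros Hx Hy.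
  apply is_series_ext with (fun n => dot (v x n) y).
  - intro n. unfold v. rewrite dot_scal_l, (dot_comm y). reflexivity.
  - apply (vseries_dot (v x) y (ell2_diag_term x) (ex_diag_nrm x Hx) Hy).
Qed.

Lemma diag_sym (x y : nat -> R) :
  ell2 x -> ell2 y -> dot (diag_op s e x) y = dot x (diag_op s e y).
Proof.
  intros Hx Hy. rewrite (dot_comm x).
  rewrite <- (is_series_unique _ _ (dot_diag x y Hx Hy)).
  rewrite <- (is_series_unique _ _ (dot_diag y x Hy Hx)).
  apply Series_ext. intro n. ring.
Qed.

Lemma diag_positive (x : nat -> R) : ell2 x -> 0 <= dot (diag_op s e x) x.
Proof.
  intro Hx. rewrite <- (is_series_unique _ _ (dot_diag x x Hx Hx)).
  apply Series_nonneg; [|eexists; apply (dot_diag x x Hx Hx)].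
  intro n. rewrite Rmult_assoc. apply Rmult_le_pos; [apply Hs0 | apply Rle_0_sqr].
Qed.

Lemma diag_lin (a b : R) (x y : nat -> R) :
  ell2 x -> ell2 y -> diag_op s e (lin a x b y) = lin a (diag_op s e x) b (diag_op s e y).
Proof.
  intros Hx Hy. apply functional_extensionality. intro i. unfold diag_op, lin at 2.
  rewrite <- Series_lin.
  - apply Series_ext. intro n. rewrite dot_lin_l by auto. ring.
  - apply (ex_vseries (v x) (ell2_diag_term x) (ex_diag_nrm x Hx)).
  - apply (ex_vseries (v y) (ell2_diag_term y) (ex_diag_nrm y Hy)).
Qed.

Lemma diag_basis (k : nat) : diag_op s e (e k) = fun i => s k * e k i.
Proof.
  apply functional_extensionality. intro i. unfold diag_op.
  rewrite <- (Rmult_1_r (s k)), <- (He1 k).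
  apply is_series_unique, (is_series_single (fun n => s n * dot (e k) (e n) * e n i) k).
  intros n Hn. rewrite Ho by auto. ring.
Qed.

End Diagonal.

(** Lets [P (P x) = B x] be tested against each basis vector, without expanding [x] in the basis. *)
Lemma eq_of_dot_total (e : nat -> nat -> R) (x y : nat -> R) :
  (forall n, ell2 (e n)) ->
  (forall z, ell2 z -> (forall n, dot z (e n) = 0) -> forall i, z i = 0) ->
  ell2 x -> ell2 y -> (forall n, dot x (e n) = dot y (e n)) -> x = y.
Proof.
  intros He Ht Hx Hy H. apply functional_extensionality. intro i.
  pose proof (Ht (lin 1 x (-1) y) (ell2_lin _ _ _ _ Hx Hy)) as H0.
  enough (lin 1 x (-1) y i = 0) by (unfold lin in *; lra).
  apply H0. intro n. rewrite dot_lin_l, H by auto. ring.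
Qed.

(** * Complexification *)

Definition cre (x : vec) : nat -> R := fun n => fst (x n).
Definition cim (x : vec) : nat -> R := fun n => snd (x n).
Definition cplx (T : (nat -> R) -> nat -> R) (x : vec) : vec :=
  fun i => (T (cre x) i, T (cim x) i).

Lemma Cmod_sq (z : C) : Cmod z ^ 2 = fst z ^ 2 + snd z ^ 2.
Proof. unfold Cmod. apply pow2_sqrt. nra. Qed.

Lemma l2_iff (x : vec) : l2 x <-> ell2 (cre x) /\ ell2 (cim x).
Proof.
  split.
  - intro H. split; apply (ex_series_dominated _ (fun n => Cmod (x n) ^ 2)); try exact H;
      intro n; rewrite Rabs_pos_eq, Cmod_sq by apply pow2_ge_0; unfold cre, cim; nra.
  - intros [H1 H2]. apply (ex_series_ext (fun n => 1 * cre x n ^ 2 + 1 * cim x n ^ 2)).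
    + intro n. rewrite !Rmult_1_l, Cmod_sq. reflexivity.
    + apply ex_series_lin; assumption.
Qed.

Lemma l2norm_eq (x : vec) :
  l2 x -> l2norm x = sqrt (nrm (cre x) ^ 2 + nrm (cim x) ^ 2).
Proof.
  intro H. apply l2_iff in H. destruct H as [H1 H2]. unfold l2norm. f_equal.
  rewrite !nrm_sq, !dot_sq by assumption.
  rewrite (Series_ext _ (fun n => 1 * cre x n ^ 2 + 1 * cim x n ^ 2)).
  - rewrite Series_lin by assumption. ring.
  - intro n. rewrite !Rmult_1_l, Cmod_sq. reflexivity.
Qed.

Lemma inner_eq (x y : vec) :
  l2 x -> l2 y ->
  inner x y = (dot (cre x) (cre y) + dot (cim x) (cim y),
               dot (cim x) (cre y) - dot (cre x) (cim y)).
Proof.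
  intros Hx Hy. apply l2_iff in Hx. apply l2_iff in Hy.
  destruct Hx as [Hx1 Hx2], Hy as [Hy1 Hy2].
  unfold inner, dot. f_equal.
  - rewrite <- Series_plus by (apply ex_dot; assumption).
    apply Series_ext. intro n. unfold cre, cim. simpl. ring.
  - rewrite <- Series_minus by (apply ex_dot; assumption).
    apply Series_ext. intro n. unfold cre, cim. simpl. ring.
Qed.

Lemma l2_cplx (T : (nat -> R) -> nat -> R) (x : vec) :
  (forall y, ell2 y -> ell2 (T y)) -> l2 x -> l2 (cplx T x).
Proof.
  intros HT Hx. apply l2_iff in Hx. apply l2_iff.
  split; [apply (HT (cre x)), Hx | apply (HT (cim x)), Hx].
Qed.

Lemma bounded_op_cplx (T : (nat -> R) -> nat -> R) (K : R) :
  0 <= K ->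
  (forall x, ell2 x -> ell2 (T x)) ->
  (forall a b x y, ell2 x -> ell2 y -> T (lin a x b y) = lin a (T x) b (T y)) ->
  (forall x, ell2 x -> nrm (T x) <= K * nrm x) ->
  bounded_op (cplx T).
Proof.
  intros HK HT Hlin Hb. split; [|split; [|split]].
  - intros x. apply l2_cplx, HT.
  - intros x y Hx Hy i. apply l2_iff in Hx. apply l2_iff in Hy.
    unfold cplx.
    replace (cre (vadd x y)) with (lin 1 (cre x) 1 (cre y)).
    2: { apply functional_extensionality. intro n. unfold lin, cre. simpl. ring. }
    replace (cim (vadd x y)) with (lin 1 (cim x) 1 (cim y)).
    2: { apply functional_extensionality. intro n. unfold lin, cim. simpl. ring. }
    rewrite !Hlin by tauto. unfold lin, Cplus. simpl. f_equal; ring.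
  - intros c x Hx i. apply l2_iff in Hx. unfold cplx.
    replace (cre (vscal c x)) with (lin (fst c) (cre x) (- snd c) (cim x)).
    2: { apply functional_extensionality. intro n. unfold lin, cre, cim. simpl. ring. }
    replace (cim (vscal c x)) with (lin (fst c) (cim x) (snd c) (cre x)).
    2: { apply functional_extensionality. intro n. unfold lin, cre, cim. simpl. ring. }
    rewrite !Hlin by tauto. unfold lin, Cmult. simpl. f_equal; ring.
  - exists K. intros x Hx. rewrite !l2norm_eq by (try apply l2_cplx; assumption).
    apply l2_iff in Hx. destruct Hx as [H1 H2].
    rewrite <- (sqrt_pow2 K HK), <- sqrt_mult_alt by apply pow2_ge_0.
    apply sqrt_le_1_alt. rewrite Rmult_plus_distr_l, <- !Rpow_mult_distr.
    change (cre (cplx T x)) with (T (cre x)). change (cim (cplx T x)) with (T (cim x)).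
    apply Rplus_le_compat; (apply pow_incr; split; [apply nrm_ge_0 | apply Hb; assumption]).
Qed.

(** The imaginary part is [<T b, a> - <T a, b>] for [x = a + i b], which symmetry cancels; the real
    part is [<T a, a> + <T b, b>]. *)
Lemma positive_op_cplx (T : (nat -> R) -> nat -> R) :
  (forall x, ell2 x -> ell2 (T x)) ->
  (forall x y, ell2 x -> ell2 y -> dot (T x) y = dot x (T y)) ->
  (forall x, ell2 x -> 0 <= dot (T x) x) ->
  positive_op (cplx T).
Proof.
  intros HT Hsym Hpos x Hx. rewrite inner_eq by (try apply l2_cplx; assumption).
  apply l2_iff in Hx. destruct Hx as [H1 H2].
  change (cre (cplx T x)) with (T (cre x)). change (cim (cplx T x)) with (T (cim x)).
  simpl. split.
  - apply Rplus_le_le_0_compat; apply Hpos; assumption.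
  - rewrite (Hsym (cim x)), (dot_comm (cim x)) by assumption. ring.
Qed.

(** Totality survives complexification because pairing with a real vector treats real and imaginary
    parts separately. *)
Lemma onb_RtoC (e : nat -> nat -> R) :
  (forall n, ell2 (e n)) -> (forall n, dot (e n) (e n) = 1) ->
  (forall m n, m <> n -> dot (e m) (e n) = 0) ->
  (forall x, ell2 x -> (forall n, dot x (e n) = 0) -> forall i, x i = 0) ->
  onb (fun n i => RtoC (e n i)).
Proof.
  intros He H1 Ho Ht.
  assert (Hl : forall n, l2 (fun i => RtoC (e n i))).
  { intro n. apply l2_iff. split; [apply He | exact ell2_0]. }
  split; [exact Hl|]. split.
  - intros m n. rewrite inner_eq by auto.
    change (cre (fun i => RtoC (e m i))) with (e m).
    change (cre (fun i => RtoC (e n i))) with (e n).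
    change (cim (fun i => RtoC (e m i))) with (fun _ : nat => 0).
    change (cim (fun i => RtoC (e n i))) with (fun _ : nat => 0).
    rewrite !dot_0_l, dot_0_r.
    destruct (Nat.eqb_spec m n) as [->|Hne].
    + rewrite H1. unfold RtoC. f_equal; ring.
    + rewrite Ho by exact Hne. unfold RtoC. f_equal; ring.
  - intros x Hx H.
    assert (Hxe : forall n, dot (cre x) (e n) = 0 /\ dot (cim x) (e n) = 0).
    { intro n. specialize (H n). rewrite inner_eq in H by auto.
      change (cre (fun i => RtoC (e n i))) with (e n) in H.
      change (cim (fun i => RtoC (e n i))) with (fun _ : nat => 0) in H.
      rewrite !dot_0_r in H. injection H as Hr Hi. lra. }
    apply l2_iff in Hx. destruct Hx as [Hr Hi].
    intro i. rewrite (surjective_pairing (x i)). unfold RtoC. f_equal.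
    + apply (Ht (cre x) Hr). intro n. apply Hxe.
    + apply (Ht (cim x) Hi). intro n. apply Hxe.
Qed.

(** [Series] has a value even when the series diverges; convergence of the rows makes [mat_apply]
    genuine matrix multiplication. *)
Lemma dominated_mat_conv (M : nat -> nat -> R) (u : nat -> R) (x : vec) :
  dominated M u -> l2 x -> mat_conv M x.
Proof.
  intros HM Hx i. apply l2_iff in Hx. destruct Hx as [H1 H2].
  split; [apply (ex_mv M u HM (cre x)), H1 | apply (ex_mv M u HM (cim x)), H2].
Qed.

Theorem dominated_trace_class (M : nat -> nat -> R) (u : nat -> R) :
  dominated M u -> trace_class (mat_apply M).
Proof.
  intro HM.
  change (mat_apply M) with (cplx (mv M)).
  destruct (eigenbasis M u HM) as (e & Heig & Ho & Ht).
  assert (He : forall n, ell2 (e n)) by (intro; apply Heig).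
  assert (He1 : forall n, dot (e n) (e n) = 1) by (intro; apply Heig).
  set (s := fun n => nrm (mv M (e n))).
  assert (Hs0 : forall n, 0 <= s n) by (intro; apply nrm_ge_0).
  assert (Hs : ex_series s) by (apply (ex_series_singular_values M u HM); assumption).
  assert (HA : forall x, ell2 x -> ell2 (mv M x)) by exact (ell2_mv M u HM).
  assert (HP := ell2_diag s e Hs0 Hs He He1).
  assert (Hsym := diag_sym s e Hs0 Hs He He1).
  assert (HPe := diag_basis s e He1 Ho).
  (* Both sides have [n]-th coefficient [s n ^ 2 * dot x (e n)], since [s n ^ 2] is the eigenvalue
     of [B] at [e n]. *)
  assert (HPP : forall x, ell2 x -> diag_op s e (diag_op s e x) = gram M x).
  { intros x Hx. apply (eq_of_dot_total e); auto.
    - apply (ell2_gram M u HM), Hx.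
    - intro n. rewrite (gram_sym M u HM), Hsym, HPe, dot_scal_r, Hsym, HPe by auto.
      destruct (Heig n) as (_ & _ & ->).
      rewrite !dot_scal_r, <- nrm_sq by auto. unfold s. ring. }
  split.
  { apply bounded_op_cplx with (nrm u * Series u).
    - destruct HM as (H0 & Hu & _).
      apply Rmult_le_pos; [apply nrm_ge_0 | apply Series_nonneg; assumption].
    - exact HA.
    - exact (mv_lin M u HM).
    - exact (nrm_mv_bounded M u HM). }
  exists (cplx (diag_op s e)). split; [|split; [|split]].
  - apply bounded_op_cplx with (Series s).
    + apply Series_nonneg; assumption.
    + exact HP.
    + exact (diag_lin s e Hs0 Hs He He1).
    + exact (nrm_diag_le s e Hs0 Hs He He1).
  - apply positive_op_cplx; [exact HP | exact Hsym|].
    exact (diag_positive s e Hs0 Hs He He1).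
  - intros x y Hx Hy.
    rewrite !inner_eq by (repeat apply l2_cplx; assumption).
    apply l2_iff in Hx. apply l2_iff in Hy. destruct Hx as [Hx1 Hx2], Hy as [Hy1 Hy2].
    change (cre (cplx (diag_op s e) (cplx (diag_op s e) x)))
      with (diag_op s e (diag_op s e (cre x))).
    change (cim (cplx (diag_op s e) (cplx (diag_op s e) x)))
      with (diag_op s e (diag_op s e (cim x))).
    rewrite !HPP, !(dot_gram M u HM) by assumption. reflexivity.
  - exists (fun n i => RtoC (e n i)), s. split; [|split].
    + apply onb_RtoC; assumption.
    + intros n i. unfold cplx.
      change (cre (fun i => RtoC (e n i))) with (e n).
      change (cim (fun i => RtoC (e n i))) with (fun _ : nat => 0).
      rewrite HPe. unfold RtoC, Cmult. simpl. f_equal; [ring|].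
      unfold diag_op. rewrite (Series_ext _ (fun k => 0 * e k i)).
      * rewrite Series_scal_l. ring.
      * intro k. rewrite dot_0_l. ring.
    + exact Hs.
Qed.

(** * Decay of QNC *)

(** [4^z] is the square of [2^z], and [2^z >= z]. For [z = x^k] one of the two factors [z] cancels
    the coefficient [x^k] of the series, and the other yields geometric decay. *)
Lemma Rpower_4_ge_sq (z : R) : 1 <= z -> z * z <= Rpower 4 z.
Proof.
  intro Hz. unfold Rpower.
  assert (H2 : z <= exp (z * ln 2)).
  (* [2^z = 2 * 2^(z-1) >= 2 (1 + (z-1) ln 2)], and [ln 2 > 1/2] makes this at least [z + 1]. *)
  { assert (E : exp (z * ln 2) = 2 * exp ((z - 1) * ln 2)).
    { rewrite <- (exp_ln 2) at 2 by lra. rewrite <- exp_plus. f_equal. ring. }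
    pose proof ln_lt_2. pose proof (exp_ineq1_le ((z - 1) * ln 2)).
    rewrite E. nra. }
  replace (z * ln 4) with (z * ln 2 + z * ln 2).
  - rewrite exp_plus. apply Rmult_le_compat; lra.
  - replace 4 with (2 * 2) by ring. rewrite ln_mult by lra. ring.
Qed.

Lemma Fxy_term_le (x y : R) (k : nat) :
  2 <= x -> 2 <= y ->
  Rabs (x ^ k * Rpower y (- x ^ S k) / (1 - Rpower y (- x ^ S k)) ^ 2)
    <= 8 * Rpower y (- x) * (/ 2) ^ k.
Proof.
  intros Hx Hy.
  set (z := x ^ k).
  assert (Hz : 2 ^ k <= z) by (apply pow_incr; lra).
  assert (H2k : 1 <= 2 ^ k) by (apply pow_R1_Rle; lra).
  change (x ^ S k) with (x * z).
  (* [y^(-x z) = y^(-x) y^(-x(z-1)) <= y^(-x) 4^(1-z) <= 4 y^(-x) / z^2] *)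
  assert (Ht : Rpower y (- (x * z)) <= Rpower y (- x) * (4 / (z * z))).
  { replace (- (x * z)) with (- x + - (x * (z - 1))) by ring. rewrite Rpower_plus.
    apply Rmult_le_compat_l; [left; apply exp_pos|].
    apply Rle_trans with (4 / Rpower 4 z).
    - rewrite Rpower_Ropp.
      replace (4 / Rpower 4 z) with (/ Rpower 4 (z - 1)).
      + apply Rinv_le_contravar; [apply exp_pos|].
        apply Rle_trans with (Rpower 2 (x * (z - 1))).
        * replace 4 with (Rpower 2 2).
          -- rewrite Rpower_mult. apply Rle_Rpower; [lra|]. nra.
          -- replace 2 with (INR 2) at 2 by (simpl; ring).
             rewrite Rpower_pow by lra. ring.
        * apply Rle_Rpower_l; [nra | lra].
      + unfold Rminus. rewrite Rpower_plus, Rpower_Ropp, Rpower_1 by lra.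
        pose proof (exp_pos (z * ln 4)) as Hp. fold (Rpower 4 z) in Hp. field. lra.
    - apply Rmult_le_compat_l; [lra|]. apply Rinv_le_contravar; [nra|].
      apply Rpower_4_ge_sq. lra. }
  (* This gives [(1 - t)^2 >= 9/16 > 1/2], so the denominator costs at most a factor [2]; with the
     [4] of [Ht] it makes up the constant [8]. *)
  assert (Ht4 : Rpower y (- (x * z)) <= / 4).
  { rewrite Rpower_Ropp. apply Rinv_le_contravar; [lra|].
    apply Rle_trans with (Rpower 2 2).
    - right. replace 2 with (INR 2) at 2 by (simpl; ring). rewrite Rpower_pow by lra. ring.
    - apply Rle_trans with (Rpower 2 (x * z)).
      + apply Rle_Rpower; [lra|]. nra.
      + apply Rle_Rpower_l; [nra | lra]. }
  set (t := Rpower y (- (x * z))) in *.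
  assert (Ht0 : 0 < t) by apply exp_pos.
  assert (Hw0 : 0 < Rpower y (- x)) by apply exp_pos.
  set (w := Rpower y (- x)) in *.
  assert (Hd : 0 < (1 - t) ^ 2) by (apply pow_lt; lra).
  rewrite Rabs_pos_eq.
  2: { apply Rlt_le, Rdiv_lt_0_compat; [apply Rmult_lt_0_compat; lra | exact Hd]. }
  apply Rle_trans with (2 * (z * t)).
  - apply Rle_div_l; [exact Hd|].
    assert (1 <= 2 * (1 - t) ^ 2) by nra.
    assert (0 <= z * t) by (apply Rmult_le_pos; lra). nra.
  - apply Rle_trans with (2 * (z * (w * (4 / (z * z))))).
    + apply Rmult_le_compat_l; [lra|]. apply Rmult_le_compat_l; lra.
    + replace (2 * (z * (w * (4 / (z * z))))) with (8 * w * / z) by (field; lra).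
      apply Rmult_le_compat_l; [lra|]. rewrite pow_inv. apply Rinv_le_contravar; lra.
Qed.

Lemma Fxy_le (x y : R) : 2 <= x -> 2 <= y -> Rabs (Fxy x y) <= 16 * Rpower y (- x).
Proof.
  intros Hx Hy. unfold Fxy.
  apply Rle_trans with (Series (fun k => 8 * Rpower y (- x) * (/ 2) ^ k)).
  - apply Series_abs_le.
    + intro k. apply Fxy_term_le; assumption.
    + apply ex_series_mult_l, ex_geom.
  - rewrite Series_scal_l, Series_geom by (rewrite Rabs_pos_eq; lra).
    right. field.
Qed.

Lemma QNC_le (x y : R) :
  2 <= x -> 2 <= y -> Rabs (QNC x y) <= 2 * (Rpower y (- x) + Rpower x (- y)).
Proof.
  intros Hx Hy. unfold QNC.
  pose proof (Fxy_le x y Hx Hy) as H1. pose proof (Fxy_le y x Hy Hx) as H2.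
  set (a := Rpower y (- x)) in *. set (b := Rpower x (- y)) in *.
  assert (0 < a) by apply exp_pos. assert (0 < b) by apply exp_pos.
  assert (Hxy : 0 < 12 * x * y) by nra.
  rewrite Rabs_mult, Rabs_inv, (Rabs_pos_eq (12 * x * y)) by lra.
  apply (Rmult_le_reg_l (12 * x * y)); [exact Hxy|].
  rewrite <- Rmult_assoc, Rinv_r, Rmult_1_l by lra.
  (* Uses [y - 1 <= y] and [x - 1 <= x]. Division by [12 x y] leaves [16/12], rounded up to [2]. *)
  apply Rle_trans with (x * y * (16 * a) + x * y * (16 * b)).
  - unfold Rminus at 1. apply Rle_trans with (1 := Rabs_triang _ _). rewrite Rabs_Ropp.
    apply Rplus_le_compat; rewrite Rabs_mult, Rabs_pos_eq by nra;
      (apply Rmult_le_compat; [nra | apply Rabs_pos | nra | assumption]).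
  - assert (0 < x * y * (a + b)) by (apply Rmult_lt_0_compat; nra). nra.
Qed.

(** [y^x >= (n+2)^(m+2) >= 2^m (n+2)^2]: keeping two factors [n + 2] and lowering the others to [2]
    separates the indices and leaves both sequences summable. *)
Lemma Rpower_neg_le (m n : nat) (x y : R) :
  INR m + 2 <= x -> INR n + 2 <= y ->
  Rpower y (- x) <= (/ 2) ^ m * (/ (INR n + 2)) ^ 2.
Proof.
  intros Hx Hy. pose proof (pos_INR m). pose proof (pos_INR n).
  rewrite Rpower_Ropp, !pow_inv, <- Rinv_mult.
  apply Rinv_le_contravar.
  { apply Rmult_lt_0_compat; apply pow_lt; lra. }
  apply Rle_trans with (Rpower (INR n + 2) (INR (m + 2))).
  - rewrite Rpower_pow, pow_add by lra.
    apply Rmult_le_compat_r; [apply pow_le; lra|]. apply pow_incr. lra.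
  - apply Rle_trans with (Rpower (INR n + 2) x).
    + apply Rle_Rpower; [lra|]. rewrite plus_INR. simpl. lra.
    + apply Rle_Rpower_l; lra.
Qed.

Lemma ex_inv_sq : ex_series (fun n => (/ (INR n + 2)) ^ 2).
Proof.
  (* telescoping: [1/(n+2)^2 <= 1/(n+1) - 1/(n+2)] *)
  apply (ex_series_bounded _ 1).
  - intro n. apply pow2_ge_0.
  - intro N. enough (psum (fun n => (/ (INR n + 2)) ^ 2) N <= 1 - / (INR N + 1)).
    { pose proof (Rinv_0_lt_compat _ (INRp1_pos N)). lra. }
    induction N as [|N IH].
    + simpl. rewrite Rplus_0_l, Rinv_1. lra.
    + rewrite S_INR. cbn [psum]. pose proof (pos_INR N).
      replace (INR N + 1 + 1) with (INR N + 2) by ring.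
      assert ((/ (INR N + 2)) ^ 2 <= / (INR N + 1) - / (INR N + 2)); [|lra].
      replace (/ (INR N + 1) - / (INR N + 2)) with (/ (INR N + 2) * / (INR N + 1))
        by (field; lra).
      simpl. rewrite Rmult_1_r. apply Rmult_le_compat_l.
      * left. apply Rinv_0_lt_compat. lra.
      * apply Rinv_le_contravar; lra.
Qed.

(** The two halves of [QNC] give [2 g_i q_j + 2 q_i g_j] with [g] geometric and [q] inverse square.
    These are exactly the cross terms of [(2 g_i + q_i) (2 g_j + q_j)]. The factor [1 *] fits the
    shape of [ex_series_lin]. *)
Definition prime_weight (n : nat) : R := 2 * (/ 2) ^ n + 1 * (/ (INR n + 2)) ^ 2.

Lemma dominated_QNC (p : nat -> nat) :
  (forall n, (n + 2 <= p n)%nat) ->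
  dominated (fun i j => QNC (INR (p i)) (INR (p j))) prime_weight.
Proof.
  intro Hp.
  assert (Hg : forall n, 0 <= (/ 2) ^ n) by exact geom_ge_0.
  assert (Hq : forall n, 0 <= (/ (INR n + 2)) ^ 2) by (intro; apply pow2_ge_0).
  assert (HpR : forall n, INR n + 2 <= INR (p n)).
  { intro n. specialize (Hp n). apply le_INR in Hp. rewrite plus_INR in Hp. exact Hp. }
  split; [|split].
  - intro n. unfold prime_weight. specialize (Hg n). specialize (Hq n). lra.
  - apply ex_series_lin; [exact ex_geom | exact ex_inv_sq].
  - intros i j.
    pose proof (pos_INR i). pose proof (pos_INR j).
    pose proof (HpR i). pose proof (HpR j).
    apply Rle_trans with (1 := QNC_le (INR (p i)) (INR (p j)) ltac:(lra) ltac:(lra)).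
    pose proof (Rpower_neg_le i j (INR (p i)) (INR (p j)) ltac:(lra) ltac:(lra)) as Hij.
    pose proof (Rpower_neg_le j i (INR (p j)) (INR (p i)) ltac:(lra) ltac:(lra)) as Hji.
    unfold prime_weight.
    pose proof (Rmult_le_pos _ _ (Hg i) (Hg j)).
    pose proof (Rmult_le_pos _ _ (Hq i) (Hq j)).
    nra.
Qed.

Lemma prime_enum_ge (p : nat -> nat) (n : nat) : prime_enum p -> (n + 2 <= p n)%nat.
Proof.
  intros (Hprime & Hincr & _). induction n as [|n IH].
  - pose proof (prime_ge_2 _ (Hprime O)). lia.
  - specialize (Hincr n). lia.
Qed.

Theorem theorem2p1 (p : nat -> nat) (hp : prime_enum p) :
  let Rm := fun i j : nat => QNC (INR (p i)) (INR (p j)) in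
  (forall x : vec, l2 x -> mat_conv Rm x) /\ trace_class (mat_apply Rm).
Proof.
  intro Rm.
  assert (HM : dominated Rm prime_weight).
  { apply dominated_QNC. intro n. apply prime_enum_ge, hp. }
  split.
  - intros x. apply (dominated_mat_conv Rm prime_weight x HM).
  - apply (dominated_trace_class Rm prime_weight HM).
Qed.
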